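(* Let $m\ge 3$ be an integer for which there exists a regular ternary $m$-gonal form. Then $$ m\le \begin{cases}35&\text{if}\ \ m\equiv 1\pmod 2,\ m\equiv 2\pmod 3,\\ 147&\text{if}\ \ m\equiv 1\pmod 2,\ m\not\equiv 2\pmod 3,\\ 38&\text{if}\ \ m\equiv 2\pmod 4,\ m\equiv 2\pmod 3,\\ 142&\text{if}\ \ m\equiv 2\pmod 4,\ m\not\equiv 2\pmod 3,\\ 188&\text{if}\ \ m\equiv 0\pmod 4,\ m\equiv 2\pmod 3,\\ 712&\text{if}\ \ m\equiv 0\pmod 4,\ m\not\equiv 2\pmod 3.\end{cases} $$
   Context: For an integer $m\ge 3$ let $P_m(x)=\frac{(m-2)x^2-(m-4)x}{2}$. A ternary $m$-gonal form is a polynomial $f=a_1P_m(x_1)+a_2P_m(x_2)+a_3P_m(x_3)$ with $a_1,a_2,a_3$ positive integers. An integer $n$ is represented by $f$ if $f(x_1,x_2,x_3)=n$ has a solution in $\mathbb{Z}^3$; it is locally represented by $f$ if this equation has a solution in $\mathbb{Z}_p^3$ for every prime $p$ and a solution in $\mathbb{R}^3$. The form $f$ is called regular if it represents every nonnegative integer that is locally represented by $f$. *)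

(* Defs.v *)
From Stdlib Require Import ZArith Znumtheory Reals.

Open Scope Z_scope.

(* The m-gonal number P_m(x) = ((m-2)x^2 - (m-4)x)/2 for integer x
   (the numerator is always even, so the division is exact). *)
Definition Pm (m x : Z) : Z := ((m - 2) * x * x - (m - 4) * x) / 2.

Definition twoPm (m x : Z) : Z := (m - 2) * x * x - (m - 4) * x.

Definition gonal_form (m a1 a2 a3 x1 x2 x3 : Z) : Z :=
  a1 * Pm m x1 + a2 * Pm m x2 + a3 * Pm m x3.

Definition represented (m a1 a2 a3 n : Z) : Prop :=
  exists x1 x2 x3 : Z, gonal_form m a1 a2 a3 x1 x2 x3 = n.

(* p-adic integers as the inverse limit of Z/p^k Z: an element of Z_p is
   represented by a coherent sequence of integers (x_k)_k with
   x_{k+1} = x_k (mod p^k). *)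
Definition padic_coherent (p : Z) (x : nat -> Z) : Prop :=
  forall k : nat, (p ^ Z.of_nat k | x (S k) - x k).

(* f(x1,x2,x3) = n has a solution in Z_p^3.  Since 2 is not a zero divisor
   in Z_p, this is the equation 2 f(x) = 2 n, i.e. the integer-coefficient
   polynomial identity sum a_i ((m-2)x_i^2 - (m-4)x_i) = 2n, which holds in
   Z_p = lim Z/p^k iff it holds modulo p^k at every level k. *)
Definition padic_solvable (p m a1 a2 a3 n : Z) : Prop :=
  exists x1 x2 x3 : nat -> Z,
    padic_coherent p x1 /\ padic_coherent p x2 /\ padic_coherent p x3 /\
    forall k : nat,
      (p ^ Z.of_nat k |
         a1 * twoPm m (x1 k) + a2 * twoPm m (x2 k) + a3 * twoPm m (x3 k) - 2 * n).

Definition real_Pm (m : Z) (x : R) : R :=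
  ((IZR (m - 2) * x * x - IZR (m - 4) * x) / 2)%R.

Definition real_solvable (m a1 a2 a3 n : Z) : Prop :=
  exists x1 x2 x3 : R,
    (IZR a1 * real_Pm m x1 + IZR a2 * real_Pm m x2 + IZR a3 * real_Pm m x3)%R
    = IZR n.

Definition locally_represented (m a1 a2 a3 n : Z) : Prop :=
  (forall p : Z, prime p -> padic_solvable p m a1 a2 a3 n) /\
  real_solvable m a1 a2 a3 n.

Definition regular (m a1 a2 a3 : Z) : Prop :=
  forall n : Z, 0 <= n -> locally_represented m a1 a2 a3 n ->
    represented m a1 a2 a3 n.

Definition exists_regular_ternary (m : Z) : Prop :=
  exists a1 a2 a3 : Z, 0 < a1 /\ 0 < a2 /\ 0 < a3 /\ regular m a1 a2 a3.

(* Main.v *)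
Require Import Defs.
From Stdlib Require Import ZArith Znumtheory Reals Lra Lia List Classical.
From mathcomp Require Import ssreflect ssrbool ssrfun.
Open Scope Z_scope.

(* Put M = m - 2. Completing squares, n is represented iff
   8 M n + sum a_i s_i^2 = sum a_i X_i^2 with X_i = s_i mod 2 M, where initially
   s_i = - (m - 4). At most 8 such n are below M / 2, whereas the local
   conditions only concern primes not dividing M. Watson's transformation makes
   the coefficients pairwise prime at these primes, at the price of other shifts
   s_i. Then n is locally represented as soon as it lies in a suitable class
   modulo 1, 3, 4 or 12 and the completed square 8 M n + sum a_i s_i^2 is prime to
   the bad primes, i.e. the p >= 5 dividing a1 a2 a3 but not M.
   If there are few bad primes, then more than 8 such n are below M / 2, or
   else a1 a2 a3 is smaller than the product of the bad primes. With
   a1 <= a2 <= a3, a bad prime p dividing a1 a2 also makes a3 too small: take n in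
   a class modulo p that the binary form in x1, x2 avoids. So all the bad primes
   divide a3, and every sieved n < a3 is a value of the binary form. Counting
   these values shows that there are more than 50 bad primes and that
   a1 a2 M^2 is small. Finally 4 a1 a2 w^2 - 1 has a prime factor q inert for
   - a1 a2, and some sieved n < a3 makes the binary completed square divisible by
   q but not by q^2, so that n is not a value of the binary form. *)

(** * Quadratic congruences *)

(** The number R of bad primes is not bounded in advance, so the sieve needs windows that are short
    for every R. A union bound fails once the reciprocals of the lower bounds for the primes add up
    to more than 1; from there on, windows of length 2^k for k excluded residue classes take over.
    They are short enough because a3 is at least the product of R distinct primes, which outgrows
    every c^R. The prime q exists because d = a1 a2 is a square modulo T = 4 d w^2 - 1, whereas T is
    3 modulo 4, so that - d is not a square modulo T. Since q may be as large as T, the last n stays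
    below a3 only if a1 a2 M^2 is small, which is the purpose of the counting. Moreover T has to
    avoid the bad primes: if q divided a3, it would divide the ternary completed square together
    with the binary one, and the sieve would reject n. The primes 2 and 3 would remove too much of a
    short window, hence the fixed class modulo 1, 3, 4 or 12 in place of a sieve. *)

Ltac zdiv_lia := Z.to_euclidean_division_equations; lia.

Lemma prime_inverse p a : prime p -> ~ (p | a) -> exists u, (p | u * a - 1).
Proof.
move=> pp pa; have /rel_prime_bezout[u v E] : rel_prime a p.
  by apply: rel_prime_sym; apply: prime_rel_prime.
by exists u, (- v); lia.
Qed.

Lemma prime_not_divide_mul p a b : prime p -> ~ (p | a) -> ~ (p | b) -> ~ (p | a * b).
Proof. by move=> pp pa pb /(prime_mult _ pp)[]. Qed.

Lemma hensel_quadratic p A B C x0 : prime p ->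
  (p | A * x0 * x0 + B * x0 + C) -> ~ (p | 2 * A * x0 + B) ->
  exists x, padic_coherent p x /\
    forall k, (p ^ Z.of_nat k | A * x k * x k + B * x k + C).
Proof.
move=> pp H0 H1; have [u [v Hu]] := prime_inverse _ _ pp H1.
set F := fun y => A * y * y + B * y + C.
(* Newton iteration with a fixed multiplier u, the inverse of the derivative at x0: all iterates
   stay congruent to x0 modulo p, so each step gains one factor p. The root [x k] is valid modulo
   p^(k+1). *)
pose x := nat_rect (fun _ => Z) x0 (fun _ y => y - u * F y).
have xS k : x (S k) = x k - u * F (x k) by [].
have inv k : (p ^ Z.of_nat (S k) | F (x k)) /\ (p | x k - x0).
  elim: k => [|k [[c Hc] [d Hd]]].
    by split; [rewrite Z.pow_1_r | exists 0; rewrite /=; lia].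
  have E : p ^ Z.of_nat (S k) = p * p ^ Z.of_nat k by rewrite -Z.pow_succ_r; [congr Z.pow; lia|lia].
  split; last first.
    by rewrite xS Hc E; exists (d - u * c * p ^ Z.of_nat k); lia.
  rewrite xS.
  have -> : F (x k - u * F (x k)) =
    F (x k) * (1 - u * (2 * A * x k + B)) + A * u * u * F (x k) * F (x k).
    by rewrite /F; ring.
  have -> : 1 - u * (2 * A * x k + B) = p * (- v - 2 * u * A * d).
    have -> : x k = x0 + d * p by lia.
    have -> : 1 = u * (2 * A * x0 + B) - v * p by lia.
    ring.
  have -> : p ^ Z.of_nat (S (S k)) = p * p ^ Z.of_nat (S k).
    by rewrite -Z.pow_succ_r; [congr Z.pow; lia|lia].
  rewrite Hc; exists (c * (- v - 2 * u * A * d) + A * u * u * c * c * p ^ Z.of_nat k).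
  by rewrite {3}E; ring.
exists x; split=> k.
  have [[c Hc] _] := inv k; rewrite xS Hc.
  have -> : p ^ Z.of_nat (S k) = p * p ^ Z.of_nat k by rewrite -Z.pow_succ_r; [congr Z.pow; lia|lia].
  by exists (- u * c * p); ring.
have [[c Hc] _] := inv k; rewrite -/(F (x k)) Hc.
have -> : p ^ Z.of_nat (S k) = p * p ^ Z.of_nat k by rewrite -Z.pow_succ_r; [congr Z.pow; lia|lia].
by exists (c * p); ring.
Qed.

Lemma square_eq_mod p x y : prime p -> (p | x * x - y * y) -> (p | x - y) \/ (p | x + y).
Proof.
move=> pp; have -> : x * x - y * y = (x - y) * (x + y) by ring.
exact: prime_mult.
Qed.

(** The residues modulo an odd p up to sign; for p prime, squaring is injective on them. *)
Definition half_range (p : Z) : list Z := map Z.of_nat (seq 0 (Z.to_nat ((p + 1) / 2))).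

Lemma half_range_spec p x : 2 < p -> p mod 2 = 1 -> In x (half_range p) <-> 0 <= x /\ 2 * x < p.
Proof.
move=> p2 po; rewrite /half_range in_map_iff; split.
  by case=> n [<-]; rewrite in_seq; zdiv_lia.
move=> H; exists (Z.to_nat x); split; first lia.
by rewrite in_seq; zdiv_lia.
Qed.

Definition residues (p : Z) : list Z := map Z.of_nat (seq 0 (Z.to_nat p)).

Lemma residues_mod p x : 0 < p -> In (x mod p) (residues p).
Proof.
move=> p0; rewrite /residues in_map_iff; exists (Z.to_nat (x mod p)).
have := Z.mod_pos_bound x p p0; move=> H; split; first lia.
by apply/in_seq; lia.
Qed.

Lemma divide_mod_eq p x y : 0 < p -> x mod p = y mod p -> (p | x - y).
Proof. by move=> p0 E; exists (x / p - y / p); move: (Z.div_mod x p) (Z.div_mod y p); lia. Qed.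

Lemma mod_eq_divide p x y : 0 < p -> (p | x - y) -> x mod p = y mod p.
Proof.
move=> p0 [c E].
have -> : x = y + c * p by lia.
apply: Z.mod_add. lia.
Qed.

Lemma odd_prime_mod2 p : prime p -> 2 < p -> p mod 2 = 1.
Proof.
move=> pp p2; have [H|//] : p mod 2 = 0 \/ p mod 2 = 1 by have := Z.mod_pos_bound p 2; lia.
have /(prime_divisors _ pp) : (2 | p) by apply/Z.mod_divide.
lia.
Qed.

Lemma NoDup_half_squares p a c : prime p -> 2 < p -> ~ (p | a) ->
  NoDup (map (fun x => (a * (x * x) + c) mod p) (half_range p)).
Proof.
move=> pp p2 pa; have po := odd_prime_mod2 _ pp p2.
apply: NoDup_map_NoDup_ForallPairs; last first.
  by apply: NoDup_map_NoDup_ForallPairs; [move=> x y _ _; lia | exact: seq_NoDup].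
move=> x y /half_range_spec -/(_ p2 po) Hx /half_range_spec -/(_ p2 po) Hy E.
have := divide_mod_eq p _ _ ltac:(lia) E.
have -> : a * (x * x) + c - (a * (y * y) + c) = a * (x * x - y * y) by ring.
case/(prime_mult _ pp) => // /(square_eq_mod _ _ _ pp)[[k Hk]|[k Hk]].
  have : k = 0 by nia.
  lia.
have [|] : k = 0 \/ k = 1 by nia.
  lia.
lia.
Qed.

(** Pigeonhole: a x^2 and c - b y^2 each take (p + 1) / 2 values modulo p. *)
Lemma binary_form_mod_prime p a b c : prime p -> 2 < p -> ~ (p | a) -> ~ (p | b) ->
  exists x y, (p | a * (x * x) + b * (y * y) - c).
Proof.
move=> pp p2 pa pb; have po := odd_prime_mod2 _ pp p2.
set l1 := map (fun x => (a * (x * x) + 0) mod p) (half_range p).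
set l2 := map (fun y => ((- b) * (y * y) + c) mod p) (half_range p).
have [z [Hz1 Hz2]] : exists z, In z l1 /\ In z l2.
  apply: NNPP => H.
  have N : NoDup (l1 ++ l2).
    apply: NoDup_app => //; try (by apply: NoDup_half_squares => // /Z.divide_opp_r).
    by move=> z Hz1 Hz2; apply: H; exists z.
  have : (length (l1 ++ l2) <= length (residues p))%nat.
    apply: NoDup_incl_length => // z /in_app_iff[] /in_map_iff[x [<- _]];
    by apply: residues_mod; lia.
  rewrite /residues length_app !length_map !length_seq.
  by zdiv_lia.
move: Hz1 Hz2 => /in_map_iff[x [Ex _]] /in_map_iff[y [Ey _]].
exists x, y; have := divide_mod_eq p _ _ ltac:(lia) (eq_trans Ex (eq_sym Ey)).
by congr (_ | _); ring.
Qed.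

Lemma nonresidue_exists p : prime p -> 2 < p -> exists g, forall x, ~ (p | x * x - g).
Proof.
move=> pp p2; have po := odd_prime_mod2 _ pp p2; apply: NNPP => H.
set l := map (fun x => (1 * (x * x) + 0) mod p) (half_range p).
have : (length (residues p) <= length l)%nat.
  apply: NoDup_incl_length.
    by apply: NoDup_map_NoDup_ForallPairs; [move=> x y _ _; lia | exact: seq_NoDup].
  move=> g Hg; apply: NNPP => Hl; apply: H; exists g => x Hx; apply: Hl.
  have gp : g = g mod p.
    by move: Hg => /in_map_iff[n [<-]]; rewrite in_seq => Hn; rewrite Z.mod_small; lia.
  set y := x mod p; have Hy := Z.mod_pos_bound x p ltac:(lia).
  have [m Em] : exists m, p = 2 * m + 1 by exists (p / 2); zdiv_lia.
  pose z := if 2 * y <? p then y else p - y.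
  apply/in_map_iff; exists z; split; last first.
    by apply/half_range_spec => //; rewrite /z; case: Z.ltb_spec; lia.
  rewrite gp; apply: mod_eq_divide; first lia.
  move: Hx => [k Hk]; have Ex := Z.div_mod x p ltac:(lia); rewrite -/y in Ex.
  rewrite /z; case: Z.ltb_spec => _.
    by exists (k - (x / p) * (x + y)); nia.
  by exists (k - (x / p) * (x + y) + p - 2 * y); nia.
rewrite /l /residues !length_map !length_seq.
by zdiv_lia.
Qed.

(** If g is a nonresidue, so is 4 g. Solving m n + e = b v modulo p for v = g and for v = 4 g gives
    two candidates; were m n + f divisible by p for both, p would divide 3 b g, which p >= 5
    excludes. *)
Lemma nonresidue_class p m b e f : prime p -> 5 <= p -> ~ (p | m) -> ~ (p | b) ->
  exists n, (forall x, ~ (p | m * n + e - b * (x * x))) /\ ~ (p | m * n + f).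
Proof.
move=> pp p5 pm pb; have [g Hg] := nonresidue_exists _ pp ltac:(lia).
have [u [k Hu]] := prime_inverse _ _ pp pm.
have small c : 0 < c < p -> ~ (p | c) by move=> Hc /Z.divide_pos_le; lia.
have [h [j Hh]] := prime_inverse p 2 pp (small 2 ltac:(lia)).
have um : u * m = k * p + 1 by lia.
have key v n : n = u * (b * v - e) -> forall x, (p | m * n + e - b * (x * x)) -> (p | x * x - v).
  move=> -> x [c Hc].
  have : (p | b * (x * x - v)).
    exists (k * (b * v - e) - c); move: Hc.
    have -> : m * (u * (b * v - e)) = (u * m) * (b * v - e) by ring.
    by rewrite um; lia.
  by case/(prime_mult _ pp).
have g4 x : ~ (p | x * x - 4 * g).
  move=> [c Hc]; apply: (Hg (h * x)).
  have : (p | 4 * (h * x * (h * x) - g)).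
    exists (c + j * (h * 2 + 1) * (x * x)).
    have -> : 4 * (h * x * (h * x) - g) = (h * 2) * (h * 2) * (x * x) - 4 * g by ring.
    have -> : h * 2 = j * p + 1 by lia.
    nia.
  by case/(prime_mult _ pp) => // /(small 4 ltac:(lia)).
case: (classic (p | m * (u * (b * g - e)) + f)) => [[c Hc]|H]; last first.
  by exists (u * (b * g - e)); split=> // x Hx; apply: (Hg x); apply: key Hx.
exists (u * (b * (4 * g) - e)); split.
  by move=> x Hx; apply: (g4 x); apply: key Hx.
case=> d Hd.
have : (p | b * (3 * g)).
  exists (d - c - k * (b * 3 * g)).
  have : m * (u * (b * (4 * g) - e)) = (u * m) * (b * (4 * g) - e) by ring.
  have : m * (u * (b * g - e)) = (u * m) * (b * g - e) by ring.
  rewrite um; lia.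
case/(prime_mult _ pp) => //; case/(prime_mult _ pp); first by apply: small; lia.
by move=> [i Hi]; apply: (Hg 0); exists (- i); lia.
Qed.

(** * Inert primes of binary forms *)

(** Modulo 4 D - 1, which is 3 modulo 4, a solution would make - 1 = - 4 D a square. The proof is a
    descent: z^2 + D = y (4 D - 1) means z^2 + D + y = 4 D y, which is symmetric in D and y. *)
Lemma no_square_4Dm1 D x : 0 < D -> ~ (4 * D - 1 | x * x + D).
Proof.
have [n] : exists n, (Z.to_nat D <= n)%nat by exists (Z.to_nat D).
elim: n D x => [|n IH] D x Dn D0; first lia.
set T := 4 * D - 1 => HT.
(* reduce to |x| < 2D, so that the cofactor y is again a solution, with y < D *)
have [z [Hz HTz]] : exists z, - (2 * D) < z < 2 * D /\ (T | z * z + D).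
  have Hr := Z.mod_pos_bound x T ltac:(lia); have Ex := Z.div_mod x T ltac:(lia).
  move: HT => [c Hc]; set r := x mod T in Hr Ex.
  have Tr : (T | r * r + D) by exists (c - (x / T) * (x + r)); nia.
  case: (Z.le_gt_cases r (2 * D - 1)) => Hr2; first by exists r; split; [lia|].
  exists (r - T); split; first lia.
  by move: Tr => [d Hd]; exists (d - 2 * r + T); nia.
move: HTz => [y Hy]; have y0 : 0 < y by rewrite /T in Hy; nia.
have yD : y < D by rewrite /T in Hy; nia.
apply: (IH y z); [lia | lia |].
by exists D; rewrite /T in Hy; lia.
Qed.

Lemma prime_factor T : 1 < T -> exists q, prime q /\ (q | T).
Proof.
have [n] : exists n, (Z.to_nat T <= n)%nat by exists (Z.to_nat T).
elim: n T => [|n IH] T Tn T1; first lia.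
case: (prime_dec T) => [Tp|Tp]; first by exists T; split=> //; apply: Z.divide_refl.
have [d [d1 dT]] := not_prime_divide T T1 Tp.
have [q [qp qd]] := IH d ltac:(lia) ltac:(lia).
by exists q; split=> //; apply: Z.divide_trans dT.
Qed.

Lemma square_mod_of_primes T d : 0 < T -> T mod 2 = 1 -> rel_prime T d ->
  (forall q, prime q -> (q | T) -> exists s, (q | s * s + d)) -> exists s, (T | s * s + d).
Proof.
have [n] : exists n, (Z.to_nat T <= n)%nat by exists (Z.to_nat T).
elim: n T => [|n IH] T Tn T0 To Td H; first lia.
case: (Z.eq_dec T 1) => [->|T1]; first by exists 0; apply: Z.divide_1_l.
have [q [qp [T' ET]]] : exists q, prime q /\ (q | T) by apply: prime_factor; lia.
have q2 := prime_ge_2 _ qp.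
have [i Ei] : exists i, T = 2 * i + 1 by exists (T / 2); zdiv_lia.
have q_neq2 : q <> 2 by move=> Eq; rewrite Eq in ET; lia.
have T'0 : 0 < T' by nia.
have q_ndiv_d : ~ (q | d).
  move=> qd; have : (q | 1).
    have [_ _] := Td; apply => //; by exists T'.
  by move=> /Z.divide_pos_le; lia.
have [||r rp [k Ek]|s [c Hs]] := IH T' ltac:(nia) T'0.
- have [i' Ei'] : exists i', T' = 2 * i' \/ T' = 2 * i' + 1 by exists (T' / 2); zdiv_lia.
  case: Ei' => Ei'; last by rewrite Ei'; zdiv_lia.
  have : T = 2 * (i' * q) by rewrite ET Ei'; ring.
  lia.
- by apply: rel_prime_div Td _; exists q; lia.
- apply: H => //; exists (k * q); rewrite ET Ek; ring.
(* lift the root s mod T' to s + T' z mod q T' *)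
have [z Hz] : exists z, (q | c + 2 * s * z + T' * z * z).
  (* If q divides T', the congruence for z is linear with unit coefficient 2 s; otherwise z is
     chosen so that s + T' z is a root r of the congruence modulo q. *)
  case: (classic (q | T')) => qT'.
    have qs : ~ (q | 2 * s).
      case/(prime_mult _ qp) => [/(prime_divisors 2 prime_2)|[j Ej]]; first lia.
      apply: q_ndiv_d; have [k Ek] := qT'.
      by exists (c * k - s * j); rewrite Ek in Hs; lia.
    have [u [j Hu]] := prime_inverse _ _ qp qs; have [k Ek] := qT'.
    exists (- c * u); exists (- c * j + k * c * u * c * u).
    have -> : c + 2 * s * (- c * u) = - c * (u * (2 * s) - 1) by ring.
    by rewrite Hu Ek; ring.
  have [u [j Hu]] := prime_inverse _ _ qp qT'.
  have [r [k Hr]] := H q qp ltac:(by exists T').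
  exists (u * (r - s)).
  have : (q | T' * (c + 2 * s * (u * (r - s)) + T' * (u * (r - s)) * (u * (r - s)))).
    have -> : T' * (c + 2 * s * (u * (r - s)) + T' * (u * (r - s)) * (u * (r - s))) =
      (s + (u * T') * (r - s)) * (s + (u * T') * (r - s)) + d.
      have : c * T' = s * s + d by lia.
      move=> E; have -> : d = c * T' - s * s by lia.
      ring.
    have -> : u * T' = j * q + 1 by lia.
    exists (k + j * (r - s) * (2 * r + j * q * (r - s))).
    have -> : d = k * q - r * r by lia.
    ring.
  by case/(prime_mult _ qp).
have [k Hk] := Hz; exists (s + T' * z); exists k.
have -> : (s + T' * z) * (s + T' * z) + d = T' * (c + 2 * s * z + T' * z * z).
  have -> : d = c * T' - s * s by lia.
  ring.
by rewrite Hk ET; ring.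
Qed.

(** Otherwise - d would be a square modulo every prime factor of T = 4 d w^2 - 1, hence modulo T,
    and so would - d w^2, against [no_square_4Dm1] for D = d w^2. *)
Lemma inert_prime d w : 0 < d -> 0 < w ->
  exists q, prime q /\ (q | 4 * d * w * w - 1) /\ forall s, ~ (q | s * s + d).
Proof.
move=> d0 w0; apply: NNPP => N.
have D0 : 0 < d * w * w by nia.
have [|||q qp qT|s [c Hs]] := square_mod_of_primes (4 * d * w * w - 1) d.
- nia.
- have -> : 4 * d * w * w - 1 = 1 + (2 * d * w * w - 1) * 2 by ring.
  by rewrite Z.mod_add.
- apply: bezout_rel_prime; apply: (Bezout_intro _ _ _ (-1) (4 * w * w)); ring.
- apply: NNPP => Hs; apply: N; exists q; split=> //; split=> // s Hq; apply: Hs; by exists s.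
apply: (no_square_4Dm1 (d * w * w) (s * w) D0); exists (c * w * w).
have -> : s * w * (s * w) + d * w * w = (s * s + d) * w * w by ring.
by rewrite Hs; ring.
Qed.

(** If y were a unit modulo q, then a x / y would be a square root of - a b. *)
Lemma inert_divides a b q x y : prime q -> ~ (q | a) -> ~ (q | b) ->
  (forall s, ~ (q | s * s + a * b)) -> (q | a * (x * x) + b * (y * y)) ->
  (q | x) /\ (q | y).
Proof.
move=> qp qa qb Hq [c Hc].
have qy : (q | y).
  apply: NNPP => qy; have [u [j Hu]] := prime_inverse _ _ qp qy.
  apply: (Hq (a * x * u)); exists (a * c * u * u - a * b * j * (u * y + 1)).
  have : a * x * u * (a * x * u) + a * b * (u * y) * (u * y) = a * u * u * (a * (x * x) + b * (y * y)) by ring.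
  rewrite Hc => E.
  have -> : a * x * u * (a * x * u) + a * b = a * u * u * (c * q) - a * b * (u * y - 1) * (u * y + 1).
    by lia.
  by rewrite Hu; ring.
split=> //; move: qy => [k Ek].
have : (q | a * (x * x)) by exists (c - b * k * y); rewrite Ek in Hc *; lia.
by case/(prime_mult _ qp) => // /(prime_mult _ qp)[].
Qed.

(** * Shifted polygonal forms and descent *)

(* Twice the shifted polygonal number (M x^2 + s x) / 2; the m-gonal one has
   M = m - 2 and s = - (m - 4). *)
Definition poly2 (M s x : Z) := M * x * x + s * x.

Definition form2 M a1 s1 a2 s2 a3 s3 x1 x2 x3 :=
  a1 * poly2 M s1 x1 + a2 * poly2 M s2 x2 + a3 * poly2 M s3 x3.

Definition loc_sol p M a1 s1 a2 s2 a3 s3 n := exists x1 x2 x3,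
  padic_coherent p x1 /\ padic_coherent p x2 /\ padic_coherent p x3 /\
  forall k, (p ^ Z.of_nat k | form2 M a1 s1 a2 s2 a3 s3 (x1 k) (x2 k) (x3 k) - 2 * n).

(* At the other primes the local condition holds automatically. *)
Definition constraining M p :=
  prime p /\ ((p <> 2 /\ ~ (p | M)) \/ (p = 2 /\ M mod 4 = 2)).

Definition shifted_regular M a1 s1 a2 s2 a3 s3 := forall n, 0 <= n ->
  (forall p, constraining M p -> loc_sol p M a1 s1 a2 s2 a3 s3 n) ->
  exists x1 x2 x3, form2 M a1 s1 a2 s2 a3 s3 x1 x2 x3 = 2 * n.

(** The clauses make [poly2 M s] nonnegative on the integers, even, and, when M is 2 modulo 4, half
    of it congruent to x modulo 2, so that Watson's transformation also works at the prime 2. *)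
Definition admissible M s :=
  - M <= s <= M /\ (exists i, s + M = 2 * i) /\ (M mod 4 = 2 -> (4 | s)).

Lemma loc_sol_swap12 p M a1 s1 a2 s2 a3 s3 n :
  loc_sol p M a1 s1 a2 s2 a3 s3 n -> loc_sol p M a2 s2 a1 s1 a3 s3 n.
Proof.
move=> [x1 [x2 [x3 [H1 [H2 [H3 H]]]]]]; exists x2, x1, x3; split=> //; split=> //; split=> // k.
by have := H k; congr (_ | _); rewrite /form2; ring.
Qed.

Lemma loc_sol_swap23 p M a1 s1 a2 s2 a3 s3 n :
  loc_sol p M a1 s1 a2 s2 a3 s3 n -> loc_sol p M a1 s1 a3 s3 a2 s2 n.
Proof.
move=> [x1 [x2 [x3 [H1 [H2 [H3 H]]]]]]; exists x1, x3, x2; split=> //; split=> //; split=> // k.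
by have := H k; congr (_ | _); rewrite /form2; ring.
Qed.

Lemma shifted_regular_swap12 M a1 s1 a2 s2 a3 s3 :
  shifted_regular M a1 s1 a2 s2 a3 s3 -> shifted_regular M a2 s2 a1 s1 a3 s3.
Proof.
move=> H n n0 L; have [|x1 [x2 [x3 E]]] := H n n0.
  by move=> p /L; apply: loc_sol_swap12.
by exists x2, x1, x3; rewrite -E /form2; ring.
Qed.

Lemma shifted_regular_swap23 M a1 s1 a2 s2 a3 s3 :
  shifted_regular M a1 s1 a2 s2 a3 s3 -> shifted_regular M a1 s1 a3 s3 a2 s2.
Proof.
move=> H n n0 L; have [|x1 [x2 [x3 E]]] := H n n0.
  by move=> p /L; apply: loc_sol_swap23.
by exists x1, x3, x2; rewrite -E /form2; ring.
Qed.

Lemma poly2_even M s x : (exists i, s + M = 2 * i) -> exists j, poly2 M s x = 2 * j.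
Proof.
move=> [i Hi]; rewrite /poly2.
have [h Hh] : exists h, x * (x - 1) = 2 * h.
  have [y [->|->]] : exists y, x = 2 * y \/ x = 2 * y + 1 by exists (x / 2); zdiv_lia.
    by exists (y * (2 * y - 1)); ring.
  by exists ((2 * y + 1) * y); ring.
exists (M * h + i * x).
have -> : M * x * x + s * x = M * (x * (x - 1)) + (s + M) * x by ring.
by rewrite Hh Hi; ring.
Qed.

Lemma poly2_ge0 M s x : - M <= s <= M -> 0 <= poly2 M s x.
Proof.
move=> Hs; rewrite /poly2.
have [->|[x0|x0]] : x = 0 \/ x < 0 \/ 0 < x by lia.
- lia.
- have : 0 <= (- x) * (M * (- x) - s) by apply: Z.mul_nonneg_nonneg; [lia | nia].
  lia.
have : 0 <= x * (M * x + s) by apply: Z.mul_nonneg_nonneg; [lia | nia].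
lia.
Qed.

(** The equation p s' = s + 2 M e is what turns [poly2 M s (e + p * y)] into a constant plus p^2
    times [poly2 M s' y]. An odd constraining p is invertible modulo 2 M, and s' is the
    representative in [- M, M). *)
Lemma shift_exists M s p : 0 < M -> admissible M s -> constraining M p ->
  exists s' e, p * s' = s + 2 * M * e /\ admissible M s'.
Proof.
move=> M0 [Hs [[i Hi] H4]] [pp [[p2 pM]|[-> M4]]]; last first.
  have [t Ht] := H4 M4.
  have [M' EM] : exists M', M = 4 * M' + 2 by exists (M / 4); zdiv_lia.
  have [w [Ew|Ew]] : exists w, t = 2 * w \/ t = 2 * w + 1 by exists (t / 2); zdiv_lia.
    exists (4 * w), 0; split; first lia.
    by split; [lia | split; [exists (2 * w + 2 * M' + 1); lia | move=> _; exists w; lia]].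
  (* For t odd, s / 2 = 2 t and M are both 2 modulo 4, so adding or subtracting M restores
     divisibility by 4; the sign of t tells which one keeps s' between - M and M. *)
  case: (Z.le_gt_cases t 0) => t0.
    exists (2 * t + M), 1; split; first lia.
    split; first lia.
    by split; [exists (t + M); lia | move=> _; exists (w + M' + 1); lia].
  exists (2 * t - M), (- 1); split; first lia.
  split; first lia.
  by split; [exists t; lia | move=> _; exists (w - M'); lia].
have [j Ej] : exists j, p = 2 * j + 1.
  exists (p / 2); have := odd_prime_mod2 p pp; have := prime_ge_2 p pp; zdiv_lia.
have p2M : ~ (p | 2 * M).
  by case/(prime_mult _ pp) => // /(prime_divisors 2 prime_2); have := prime_ge_2 p pp; lia.
have [u [v Huv]] : exists u, (2 * M | p * u - 1).
  have /rel_prime_bezout[u v E] : rel_prime p (2 * M) by apply: prime_rel_prime.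
  by exists u, (- v); lia.
pose s' := (u * s + M) mod (2 * M) - M.
have Ed := Z.div_mod (u * s + M) (2 * M) ltac:(lia).
have Hm := Z.mod_pos_bound (u * s + M) (2 * M) ltac:(lia).
pose e := v * s - p * ((u * s + M) / (2 * M)).
have Ee : p * s' = s + 2 * M * e.
  rewrite /s' /e; move: Ed; set q := _ / _; set r := _ mod _ => Ed.
  have -> : r = u * s + M - 2 * M * q by lia.
  have -> : p * (u * s + M - 2 * M * q - M) = (p * u) * s - 2 * M * p * q by ring.
  have -> : p * u = v * (2 * M) + 1 by lia.
  ring.
exists s', e; split=> //; split; first by rewrite /s'; lia.
split; first by exists (i + M * e - j * s'); nia.
move=> M4; have [t Ht] := H4 M4.
have [M' EM] : exists M', M = 2 * M' by exists (M / 2); zdiv_lia.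
have [g [Eg|Eg]] : exists g, p = 4 * g + 1 \/ p = 4 * g + 3.
  by exists (p / 4); zdiv_lia.
  by exists (t + M' * e - g * s'); nia.
by exists (s' + g * s' - t - M' * e); nia.
Qed.

(* Watson's transformation: on the class of n where p forces x1 = e mod p,
   substitute x1 = e + p y and divide by p. *)
Lemma watson_step M p a1 s1 b2 s2 b3 s3 : 0 < M -> constraining M p ->
  0 < a1 -> ~ (p | a1) -> admissible M s1 -> admissible M s2 -> admissible M s3 ->
  shifted_regular M a1 s1 (p * b2) s2 (p * b3) s3 ->
  exists s1', admissible M s1' /\ shifted_regular M (p * a1) s1' b2 s2 b3 s3.
Proof.
move=> M0 cp a0 pa A1 A2 A3 H; have [s' [e [Ee As']]] := shift_exists M s1 p M0 A1 cp.
have pp : prime p by case: cp.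
exists s'; split=> // n n0 L.
have shift y : poly2 M s1 (e + p * y) = poly2 M s1 e + p * p * poly2 M s' y.
  have -> : p * p * poly2 M s' y = p * p * M * y * y + p * (p * s') * y by rewrite /poly2; ring.
  by rewrite Ee /poly2; ring.
have [h Hh] := poly2_even M s1 e (proj1 (proj2 A1)).
have h0 : 0 <= h by have := poly2_ge0 M s1 e (proj1 A1); lia.
have p0 := prime_ge_2 p pp.
have [||x1 [x2 [x3 E]]] := H (p * n + a1 * h); first nia.
  move=> q /L[x1 [x2 [x3 [H1 [H2 [H3 Hk]]]]]].
  exists (fun k => e + p * x1 k), x2, x3; split.
    by move=> k; have [c Hc] := H1 k; exists (p * c); lia.
  split=> //; split=> // k; have [c Hc] := Hk k; exists (p * c).
  by rewrite -Z.mul_assoc -Hc /form2 shift Hh; ring.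
(* Modulo p, e is the vertex: the values at x1 and e differ by (x1 - e) (M (x1 - e) + p s'), and p
   must divide this because it divides the other two coefficients. For p = 2 half of the difference
   is used. *)
have [y Hy] : exists y, x1 = e + p * y.
  suff [y Hy] : (p | x1 - e) by exists y; lia.
  case: cp => _ [[p2 pM]|[E2 M4]].
    have : (p | a1 * ((x1 - e) * (M * (x1 - e) + p * s'))).
      exists (2 * n - b2 * poly2 M s2 x2 - b3 * poly2 M s3 x3).
      have -> : (x1 - e) * (M * (x1 - e) + p * s') = poly2 M s1 x1 - poly2 M s1 e.
        by rewrite Ee /poly2; ring.
      by move: E; rewrite /form2 Hh; lia.
    case/(prime_mult _ pp) => // /(prime_mult _ pp)[//|[c Hc]].
    have : (p | M * (x1 - e)) by exists (c - s'); lia.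
    by case/(prime_mult _ pp).
  have [t1 Ht1] := proj2 (proj2 A1) M4.
  have [M' EM] : exists M', M = 2 * M' + 2 * (M' + 1) by exists (M / 4); zdiv_lia.
  have [h2 Hh2] := poly2_even M s2 x2 (proj1 (proj2 A2)).
  have [h3 Hh3] := poly2_even M s3 x3 (proj1 (proj2 A3)).
  have : (2 | a1 * ((x1 - e) * (x1 - e + 2 * e))).
    exists (n - b2 * h2 - b3 * h3 - a1 * (M' * (x1 * x1 - e * e) + t1 * (x1 - e))).
    have D : poly2 M s1 x1 - poly2 M s1 e = 2 * ((2 * M' + 1) * (x1 * x1 - e * e) + 2 * t1 * (x1 - e)).
      by rewrite /poly2 EM Ht1; ring.
    have Ex : poly2 M s1 x1 = 2 * h + 2 * ((2 * M' + 1) * (x1 * x1 - e * e) + 2 * t1 * (x1 - e)) by lia.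
    by move: E; rewrite /form2 Hh2 Hh3 E2 Ex; lia.
  rewrite E2 in pa *; case/(prime_mult _ prime_2) => // /(prime_mult _ prime_2)[//|[c Hc]].
  by exists (c - e); lia.
exists y, x2, x3; move: E; rewrite Hy /form2 shift Hh => E.
apply: (Z.mul_reg_l _ _ p); [lia | lia].
Qed.

Lemma divide_step M p b1 s1 b2 s2 b3 s3 : 0 < p ->
  shifted_regular M (p * b1) s1 (p * b2) s2 (p * b3) s3 ->
  shifted_regular M b1 s1 b2 s2 b3 s3.
Proof.
move=> p0 H n n0 L; have [||x1 [x2 [x3 E]]] := H (p * n); first nia.
  move=> q /L[x1 [x2 [x3 [H1 [H2 [H3 Hk]]]]]]; exists x1, x2, x3.
  split=> //; split=> //; split=> // k; have [c Hc] := Hk k; exists (p * c).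
  by rewrite -Z.mul_assoc -Hc /form2; ring.
exists x1, x2, x3; apply: (Z.mul_reg_l _ _ p); first lia.
by rewrite /form2 in E *; lia.
Qed.

Definition pairwise_prime_to M a1 a2 a3 := forall p, constraining M p ->
  ~ ((p | a1) /\ (p | a2)) /\ ~ ((p | a1) /\ (p | a3)) /\ ~ ((p | a2) /\ (p | a3)).

(** If p divides all three coefficients, their product drops by p^3; otherwise [watson_step] leads
    to p a1, a2 / p, a3 / p, and it drops by p. *)
Lemma common_factor_step M p a1 s1 a2 s2 a3 s3 : 0 < M -> constraining M p ->
  0 < a1 -> 0 < a2 -> 0 < a3 -> admissible M s1 -> admissible M s2 -> admissible M s3 ->
  shifted_regular M a1 s1 a2 s2 a3 s3 -> (p | a2) -> (p | a3) ->
  exists b1 b2 b3 t1, 0 < b1 /\ 0 < b2 /\ 0 < b3 /\ b1 * b2 * b3 < a1 * a2 * a3 /\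
    admissible M t1 /\ shifted_regular M b1 t1 b2 s2 b3 s3.
Proof.
move=> M0 cp a10 a20 a30 A1 A2 A3 H [b2 E2] [b3 E3].
have p2 : 2 <= p by case: cp => pp _; exact: prime_ge_2.
have b20 : 0 < b2 by nia.
have b30 : 0 < b3 by nia.
rewrite E2 E3 [b2 * p]Z.mul_comm [b3 * p]Z.mul_comm in H.
case: (classic (p | a1)) => [[b1 E1]|pa1].
  rewrite E1 [b1 * p]Z.mul_comm in H.
  have b10 : 0 < b1 by nia.
  have b0 : 0 < b1 * b2 * b3 by apply: Z.mul_pos_pos => //; apply: Z.mul_pos_pos.
  exists b1, b2, b3, s1; do 3 (split; first by []).
  split.
    rewrite E1 E2 E3; have -> : b1 * p * (b2 * p) * (b3 * p) = (b1 * b2 * b3) * (p * p * p) by ring.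
    have : 8 <= p * p * p by nia.
    nia.
  by split=> //; apply: divide_step H; lia.
have [t1 [At H']] := watson_step M p a1 s1 b2 s2 b3 s3 M0 cp a10 pa1 A1 A2 A3 H.
exists (p * a1), b2, b3, t1; do 3 (split; first nia).
split; last by [].
have b0 : 0 < a1 * b2 * b3 by apply: Z.mul_pos_pos => //; apply: Z.mul_pos_pos.
rewrite E2 E3.
have -> : p * a1 * b2 * b3 = p * (a1 * b2 * b3) by ring.
have -> : a1 * (b2 * p) * (b3 * p) = p * (p * (a1 * b2 * b3)) by ring.
nia.
Qed.

Lemma descent M a1 s1 a2 s2 a3 s3 : 0 < M ->
  0 < a1 -> 0 < a2 -> 0 < a3 -> admissible M s1 -> admissible M s2 -> admissible M s3 ->
  shifted_regular M a1 s1 a2 s2 a3 s3 ->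
  exists b1 t1 b2 t2 b3 t3, 0 < b1 /\ 0 < b2 /\ 0 < b3 /\
    admissible M t1 /\ admissible M t2 /\ admissible M t3 /\
    shifted_regular M b1 t1 b2 t2 b3 t3 /\ pairwise_prime_to M b1 b2 b3.
Proof.
move=> M0; have [n] : exists n, (Z.to_nat (a1 * a2 * a3) <= n)%nat by exists (Z.to_nat (a1 * a2 * a3)).
elim: n a1 s1 a2 s2 a3 s3 => [|n IH] a1 s1 a2 s2 a3 s3 Hn a10 a20 a30 A1 A2 A3 H.
  have : 0 < a1 * a2 * a3 by apply: Z.mul_pos_pos => //; apply: Z.mul_pos_pos.
  lia.
case: (classic (pairwise_prime_to M a1 a2 a3)) => [P|P].
  by exists a1, s1, a2, s2, a3, s3.
have [p [cp]] : exists p, constraining M p /\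
  (((p | a1) /\ (p | a2)) \/ ((p | a1) /\ (p | a3)) \/ ((p | a2) /\ (p | a3))).
  apply: NNPP => N; apply: P => p cp; split; last split; move=> Hp; apply: N; exists p; tauto.
case=> [[p1 p2]|[[p1 p2]|[p1 p2]]].
- have [b3 [b1 [b2 [t [B3 [B1 [B2 [Hlt [At H']]]]]]]]] :=
    common_factor_step M p _ _ _ _ _ _ M0 cp a30 a10 a20 A3 A1 A2
      (shifted_regular_swap12 _ _ _ _ _ _ _ (shifted_regular_swap23 _ _ _ _ _ _ _ H)) p1 p2.
  by apply: (IH b3 t b1 s1 b2 s2) => //; lia.
- have [b2 [b1 [b3 [t [B2 [B1 [B3 [Hlt [At H']]]]]]]]] :=
    common_factor_step M p _ _ _ _ _ _ M0 cp a20 a10 a30 A2 A1 A3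
      (shifted_regular_swap12 _ _ _ _ _ _ _ H) p1 p2.
  by apply: (IH b2 t b1 s1 b3 s3) => //; lia.
have [b1 [b2 [b3 [t [B1 [B2 [B3 [Hlt [At H']]]]]]]]] :=
  common_factor_step M p _ _ _ _ _ _ M0 cp a10 a20 a30 A1 A2 A3 H p1 p2.
by apply: (IH b1 t b2 s2 b3 s3) => //; lia.
Qed.

(** * Local solvability of the shifted forms *)

Lemma coherent_const p c : padic_coherent p (fun _ => c).
Proof. by move=> k; exists 0; lia. Qed.

(** X_i stands for 2 M x_i + s_i. The derivative in x1 is a1 X1 modulo p, a unit, so Hensel's lemma
    applies to x1 while x2 and x3 stay fixed. *)
Lemma loc_sol_lift p M a1 s1 a2 s2 a3 s3 n X1 X2 X3 :
  prime p -> p <> 2 -> ~ (p | M) -> ~ (p | a1) -> ~ (p | X1) ->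
  (p | a1 * (X1 * X1) + a2 * (X2 * X2) + a3 * (X3 * X3)
       - (8 * M * n + a1 * (s1 * s1) + a2 * (s2 * s2) + a3 * (s3 * s3))) ->
  loc_sol p M a1 s1 a2 s2 a3 s3 n.
Proof.
move=> pp p2 pM pa1 pX1 [c Hc].
have p3 : 3 <= p by have := prime_ge_2 p pp; lia.
have p2' : ~ (p | 2) by move=> /Z.divide_pos_le; lia.
have p2M : ~ (p | 2 * M) by exact: prime_not_divide_mul.
have [u [j Hu]] := prime_inverse _ _ pp p2M.
pose x X s := u * (X - s).
have xE X s : 2 * M * x X s + s = X + p * (j * (X - s)).
  have -> : 2 * M * x X s + s = (u * (2 * M)) * (X - s) + s by rewrite /x; ring.
  have -> : u * (2 * M) = j * p + 1 by lia.
  ring.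
have sq s y : 4 * M * poly2 M s y + s * s = (2 * M * y + s) * (2 * M * y + s) by rewrite /poly2; ring.
pose C := a2 * poly2 M s2 (x X2 s2) + a3 * poly2 M s3 (x X3 s3) - 2 * n.
have [||y [coh Hy]] := hensel_quadratic p (a1 * M) (a1 * s1) C (x X1 s1) pp.
- have : (p | 4 * M * (a1 * M * x X1 s1 * x X1 s1 + a1 * s1 * x X1 s1 + C)).
    have -> : 4 * M * (a1 * M * x X1 s1 * x X1 s1 + a1 * s1 * x X1 s1 + C) =
       a1 * (4 * M * poly2 M s1 (x X1 s1) + s1 * s1) + a2 * (4 * M * poly2 M s2 (x X2 s2) + s2 * s2)
       + a3 * (4 * M * poly2 M s3 (x X3 s3) + s3 * s3)
       - (8 * M * n + a1 * (s1 * s1) + a2 * (s2 * s2) + a3 * (s3 * s3)).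
      by rewrite /C /poly2; ring.
    rewrite !sq !xE.
    set y1 := j * (X1 - s1); set y2 := j * (X2 - s2); set y3 := j * (X3 - s3).
    exists (c + a1 * y1 * (2 * X1 + p * y1) + a2 * y2 * (2 * X2 + p * y2) + a3 * y3 * (2 * X3 + p * y3)).
    rewrite !Z.mul_add_distr_r -Hc; ring.
  have p4M : ~ (p | 4 * M).
    have -> : 4 * M = 2 * (2 * M) by ring.
    exact: prime_not_divide_mul.
  by case/(prime_mult _ pp).
- have -> : 2 * (a1 * M) * x X1 s1 + a1 * s1 = a1 * (2 * M * x X1 s1 + s1) by ring.
  apply: prime_not_divide_mul => //; rewrite xE => [[d Hd]]; apply: pX1.
  by exists (d - j * (X1 - s1)); lia.
exists y, (fun _ => x X2 s2), (fun _ => x X3 s3).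
split=> //; split; first exact: coherent_const; split; first exact: coherent_const.
by move=> k; have := Hy k; congr (_ | _); rewrite /form2 /C /poly2; ring.
Qed.

(** Two unit coefficients already give every residue. To make some variable with unit coefficient a
    unit, take Z = 1 if p does not divide a3; otherwise the completed square is a unit and excludes
    X = Y = 0. *)
Lemma loc_sol_odd p M a1 s1 a2 s2 a3 s3 n :
  prime p -> p <> 2 -> ~ (p | M) -> ~ (p | a1) -> ~ (p | a2) ->
  ~ (p | a3) \/ ~ (p | 8 * M * n + a1 * (s1 * s1) + a2 * (s2 * s2) + a3 * (s3 * s3)) ->
  loc_sol p M a1 s1 a2 s2 a3 s3 n.
Proof.
move=> pp p2 pM pa1 pa2.
have p3 : 2 < p by have := prime_ge_2 p pp; lia.
set N := _ + _ + _ + _ => Hor.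
have [X [Y [Z [[c Hc] Hunit]]]] : exists X Y Z,
  (p | a1 * (X * X) + a2 * (Y * Y) + a3 * (Z * Z) - N) /\
  (~ (p | X) \/ ~ (p | Y) \/ (~ (p | a3) /\ ~ (p | Z))).
  case: Hor => Hp.
    have [X [Y [c Hc]]] := binary_form_mod_prime p a1 a2 (N - a3) pp p3 pa1 pa2.
    exists X, Y, 1; split; first by exists c; lia.
    by right; right; split=> // /Z.divide_pos_le; lia.
  have [X [Y [c Hc]]] := binary_form_mod_prime p a1 a2 N pp p3 pa1 pa2.
  exists X, Y, 0; split; first by exists c; lia.
  apply: NNPP => H; apply: Hp.
  have [x Hx] : (p | X) by apply: NNPP; tauto.
  have [y Hy] : (p | Y) by apply: NNPP; tauto.
  by exists (a1 * x * X + a2 * y * Y - c); rewrite {1}Hx {1}Hy in Hc; lia.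
case: Hunit => [pX|[pY|[pa3 pZ]]].
- by apply: (loc_sol_lift p M _ _ _ _ _ _ n X Y Z) => //; exists c; rewrite -Hc /N; ring.
- apply: loc_sol_swap12; apply: (loc_sol_lift p M _ _ _ _ _ _ n Y X Z) => //; exists c; rewrite -Hc /N; ring.
apply: loc_sol_swap23; apply: loc_sol_swap12.
by apply: (loc_sol_lift p M _ _ _ _ _ _ n Z X Y) => //; exists c; rewrite -Hc /N; ring.
Qed.

Lemma parity x : exists i, x = 2 * i \/ x = 2 * i + 1.
Proof. by exists (x / 2); zdiv_lia. Qed.

Lemma odd_witness x : ~ (2 | x) -> exists b, x = 2 * b + 1.
Proof.
by move=> xo; have [b [Eb|Eb]] := parity x; [case: xo; exists b; lia | exists b].
Qed.

(** With P the half of [poly2], the values a1 P(e + 2 y) over the 2-adic integers cover a class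
    modulo 8. As P(t2 + 2) - P(t2) is 4 modulo 8, the choice of x2 among t2 and t2 + 2 extends this
    to a class modulo 4. *)
Lemma loc_sol_two M a1 s1 a2 s2 a3 s3 : M mod 4 = 2 ->
  (4 | s1) -> (4 | s2) -> ~ (2 | a1) -> ~ (2 | a2) ->
  exists n0, forall n, (4 | n - n0) -> loc_sol 2 M a1 s1 a2 s2 a3 s3 n.
Proof.
move=> M4 [t1 E1] [t2 E2] /odd_witness[b1 Eb1] /odd_witness[b2 Eb2].
have [M' EM] : exists M', M = 4 * M' + 2 by exists (M / 4); zdiv_lia.
pose P t x := (2 * M' + 1) * x * x + 2 * t * x.
have PE t x : poly2 M (t * 4) x = 2 * P t x by rewrite /poly2 /P EM; ring.
(* This choice of e makes the linear coefficient z below odd, as Hensel's lemma requires. *)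
pose e := 1 + t1.
exists (a1 * P t1 e + a2 * P t2 t2) => n [c Hc].
have [x2 [d Hd]] : exists x2, (8 | n - a1 * P t1 e - a2 * P t2 x2).
  have [i [Ei|Ei]] := parity c.
    by exists t2, i; lia.
  exists (t2 + 2), (i - b2 - a2 * (M' * (t2 + 1) + t2)).
  have -> : P t2 (t2 + 2) = P t2 t2 + 4 * ((2 * M' + 1) * (t2 + 1) + t2) by rewrite /P; ring.
  move: Hc; rewrite Ei Eb2; move: (P t1 e) (P t2 t2) => A B; lia.
pose z := (2 * M' + 1) * e + t1.
have zo : z = 2 * (M' * e + t1) + 1 by rewrite /z /e; ring.
have [||y [coh Hy]] := hensel_quadratic 2 (a1 * (2 * M' + 1)) (a1 * z) (- 2 * d) 0 prime_2.
- by exists (- d); lia.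
- by case=> k; rewrite zo Eb1; lia.
exists (fun k => e + 2 * y k), (fun _ => x2), (fun _ => 0).
split; first by move=> k; have [q Hq] := coh k; exists (2 * q); lia.
split; first exact: coherent_const; split; first exact: coherent_const.
move=> k; have [q Hq] := Hy k; exists (8 * q).
rewrite -Z.mul_assoc -Hq /form2 E1 E2 !PE.
have -> : P t1 (e + 2 * y k) = P t1 e + 4 * ((2 * M' + 1) * (y k) * (y k) + z * y k).
  by rewrite /P /z; ring.
have -> : 2 * n = 2 * (8 * d + a1 * P t1 e + a2 * P t2 x2) by lia.
by rewrite /poly2; ring.
Qed.

(** The number that the sum of the a_i (2 M x_i + s_i)^2 must equal when n is represented. *)
Definition square_value M a1 s1 a2 s2 a3 s3 n :=
  8 * M * n + a1 * (s1 * s1) + a2 * (s2 * s2) + a3 * (s3 * s3).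

Lemma loc_sol_coprime_disc p M a1 s1 a2 s2 a3 s3 n :
  prime p -> p <> 2 -> ~ (p | M) -> pairwise_prime_to M a1 a2 a3 ->
  ((p | a1 * a2 * a3) -> ~ (p | square_value M a1 s1 a2 s2 a3 s3 n)) ->
  loc_sol p M a1 s1 a2 s2 a3 s3 n.
Proof.
move=> pp p2 pM Hpw HN; have cp : constraining M p by split=> //; left.
have [H12 [H13 H23]] := Hpw p cp.
case: (classic (p | a1 * a2 * a3)) => [|pa]; last first.
  have pa12 : ~ (p | a1 * a2) by move=> H; apply: pa; apply: Z.divide_mul_l.
  apply: loc_sol_odd => //.
  - by move=> H; apply: pa12; apply: Z.divide_mul_l.
  - by move=> H; apply: pa12; apply: Z.divide_mul_r.
  by left=> H; apply: pa; apply: Z.divide_mul_r.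
move=> pa; have {HN} pN := HN pa.
case/(prime_mult _ pp): pa => [/(prime_mult _ pp)[]|] pa.
- apply: loc_sol_swap12; apply: loc_sol_swap23; apply: loc_sol_odd => //; try tauto.
  by right; move: pN; congr (~ (_ | _)); rewrite /square_value; ring.
- apply: loc_sol_swap23; apply: loc_sol_odd => //; try tauto.
  by right; move: pN; congr (~ (_ | _)); rewrite /square_value; ring.
by apply: loc_sol_odd => //; tauto.
Qed.

Lemma two_adic_class M a1 s1 a2 s2 a3 s3 : M mod 4 = 2 ->
  admissible M s1 -> admissible M s2 -> admissible M s3 -> pairwise_prime_to M a1 a2 a3 ->
  exists n0, forall n, (4 | n - n0) -> loc_sol 2 M a1 s1 a2 s2 a3 s3 n.
Proof.
move=> M4 [_ [_ A1]] [_ [_ A2]] [_ [_ A3]] Hpw.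
have [H12 [H13 H23]] := Hpw 2 (conj prime_2 (or_intror (conj eq_refl M4))).
case: (classic (2 | a1)) => p1.
  have [||n0 H] := loc_sol_two M a2 s2 a3 s3 a1 s1 M4 (A2 M4) (A3 M4); try tauto.
  by exists n0 => n /H L; apply: loc_sol_swap12; apply: loc_sol_swap23.
case: (classic (2 | a2)) => p2.
  have [||n0 H] := loc_sol_two M a1 s1 a3 s3 a2 s2 M4 (A1 M4) (A3 M4); try tauto.
  by exists n0 => n /H L; apply: loc_sol_swap23.
exact: loc_sol_two (A1 M4) (A2 M4) p1 p2.
Qed.

(** The factor 3 is there when 3 is constraining and the factor 4 when 2 is: at these primes n is
    fixed in a class. *)
Definition step M := (if M mod 3 =? 0 then 1 else 3) * (if M mod 4 =? 2 then 4 else 1).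

Lemma constraint_class M a1 s1 a2 s2 a3 s3 : 0 < M ->
  admissible M s1 -> admissible M s2 -> admissible M s3 -> pairwise_prime_to M a1 a2 a3 ->
  shifted_regular M a1 s1 a2 s2 a3 s3 ->
  exists n0, 0 <= n0 < step M /\ forall n, 0 <= n -> (step M | n - n0) ->
    (forall p, prime p -> 5 <= p -> ~ (p | M) -> (p | a1 * a2 * a3) ->
       ~ (p | square_value M a1 s1 a2 s2 a3 s3 n)) ->
    exists x1 x2 x3, form2 M a1 s1 a2 s2 a3 s3 x1 x2 x3 = 2 * n.
Proof.
move=> M0 A1 A2 A3 Hpw Hreg.
set h3 := if M mod 3 =? 0 then 1 else 3; set h4 := if M mod 4 =? 2 then 4 else 1.
have [r4 H4] : exists r4, forall n, (h4 | n - r4) -> M mod 4 = 2 -> loc_sol 2 M a1 s1 a2 s2 a3 s3 n.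
  rewrite /h4; case: Z.eqb_spec => M4; last by exists 0.
  have [r H] := two_adic_class M a1 s1 a2 s2 a3 s3 M4 A1 A2 A3 Hpw.
  by exists r => n /H.
have [r3 H3] : exists r3, forall n, (h3 | n - r3) -> ~ (3 | M) -> ~ (3 | square_value M a1 s1 a2 s2 a3 s3 n).
  rewrite /h3; case: Z.eqb_spec => M3.
    by exists 0 => n _; case; exists (M / 3); zdiv_lia.
  (* Since 8 M is prime to 3, the completed square cannot be divisible by 3 at both n = 0 and n =
     1. *)
  have [r Hr] : exists r, ~ (3 | square_value M a1 s1 a2 s2 a3 s3 r).
    case: (classic (3 | square_value M a1 s1 a2 s2 a3 s3 0)) => [[c Hc]|]; last by exists 0.
    exists 1 => [[d Hd]]; apply: M3; rewrite /square_value in Hc Hd.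
    have -> : M = (3 * M - (d - c)) * 3 by lia.
    by rewrite Z.mod_mul.
  exists r => n [k Hk] _ [d Hd]; apply: Hr; exists (d - 8 * M * k).
  rewrite /square_value in Hd *; have En : n = r + k * 3 by lia.
  by rewrite En in Hd; lia.
have [n0 [N3 N4]] : exists n0, (h3 | n0 - r3) /\ (h4 | n0 - r4).
  rewrite /h3 /h4; case: Z.eqb_spec => _; case: Z.eqb_spec => _.
  - by exists r4; split; [exact: Z.divide_1_l | exists 0; lia].
  - by exists 0; split; exact: Z.divide_1_l.
  - by exists (4 * r3 - 3 * r4); split; [exists (r3 - r4); lia | exists (r3 - r4); lia].
  - by exists r3; split; [exists 0; lia | exact: Z.divide_1_l].
have h30 : 0 < h3 by rewrite /h3; case: Z.eqb_spec.
have h40 : 0 < h4 by rewrite /h4; case: Z.eqb_spec.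
have Eh : step M = h3 * h4 by [].
have h0 : 0 < step M by rewrite Eh; nia.
exists (n0 mod step M); split; first exact: Z.mod_pos_bound.
move=> n nn [k Hk] HN.
have {}Hk : n - n0 = h3 * h4 * (k - n0 / step M).
  by have := Z.div_mod n0 (step M) ltac:(lia); rewrite -Eh; lia.
have D3 : (h3 | n - r3).
  by move: N3 => [c Hc]; exists (c + h4 * (k - n0 / step M)); lia.
have D4 : (h4 | n - r4).
  by move: N4 => [c Hc]; exists (c + h3 * (k - n0 / step M)); lia.
apply: Hreg => // p [pp [[p2 pM]|[-> M4]]]; last exact: H4.
apply: loc_sol_coprime_disc => // pa.
case: (Z.eq_dec p 3) => [Ep|p3]; first by rewrite Ep in pM *; apply: H3.
apply: HN => //.
have p4 : p <> 4.
  by move=> Ep; have /(prime_divisors p pp) : (2 | p); [exists 2; lia | lia].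
have := prime_ge_2 p pp; lia.
Qed.

(** * From regular ternary forms to reduced shifted forms *)

Lemma real_solvable_nonneg m a1 a2 a3 n : 3 <= m -> 0 < a1 -> 0 <= n -> real_solvable m a1 a2 a3 n.
Proof.
move=> m3 a10 n0.
have E : (IZR (m - 4) = IZR (m - 2) - 2)%R by rewrite -minus_IZR; congr IZR; lia.
have HM : (0 < IZR (m - 2))%R by apply: IZR_lt; lia.
have Ha : (0 < IZR a1)%R by apply: IZR_lt.
have Hn : (0 <= IZR n)%R by apply: IZR_le.
pose q := (IZR n / IZR a1)%R.
have Hq : (0 <= q)%R by apply: Rmult_le_pos => //; left; apply: Rinv_0_lt_compat.
pose r := sqrt ((IZR (m - 2) - 2) * (IZR (m - 2) - 2) + 8 * IZR (m - 2) * q).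
have Er : (r * r = (IZR (m - 2) - 2) * (IZR (m - 2) - 2) + 8 * IZR (m - 2) * q)%R.
  apply: sqrt_sqrt; apply: Rplus_le_le_0_compat; first exact: Rle_0_sqr.
  by apply: Rmult_le_pos => //; lra.
exists ((IZR (m - 2) - 2 + r) / (2 * IZR (m - 2)))%R, 0%R, 0%R.
rewrite /real_Pm E.
have -> : IZR n = (IZR a1 * q)%R by rewrite /q; field; lra.
set M := IZR (m - 2) in HM Er *.
have -> : ((M * ((M - 2 + r) / (2 * M)) * ((M - 2 + r) / (2 * M)) - (M - 2) * ((M - 2 + r) / (2 * M))) / 2 =
   (r * r - (M - 2) * (M - 2)) / (8 * M))%R by field; lra.
rewrite Er; field; lra.
Qed.

(** The variable x1 alone suffices. The linear coefficient 2 - M, or its half when p = 2 and M is a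
    multiple of 4, is a unit and equals the derivative modulo p up to the factor b1. *)
Lemma loc_sol_unconstrained p M b1 b2 b3 n : 0 < M -> prime p -> ~ constraining M p ->
  ~ (p | b1) -> loc_sol p M b1 (2 - M) b2 (2 - M) b3 (2 - M) n.
Proof.
move=> M0 pp ncp pb.
have [x [coh Hx]] : exists x, padic_coherent p x /\
    forall k, (p ^ Z.of_nat k | b1 * poly2 M (2 - M) (x k) - 2 * n).
  case: (Z.eq_dec p 2) => [Ep|p2].
    rewrite Ep in ncp pb *; have [b Eb] := odd_witness _ pb.
    have M4 : M mod 4 <> 2 by move=> M4; apply: ncp; split; [exact: prime_2 | right].
    have [[i Mo]|[i Me]] : (exists i, M = 2 * i + 1) \/ exists i, M = 4 * i.
      have [i [Ei|Ei]] := parity M; last by left; exists i.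
      by right; exists (M / 4); zdiv_lia.
      have [||x [coh Hx]] := hensel_quadratic 2 (b1 * M) (b1 * (2 - M)) (- 2 * n) 0 prime_2.
      - by exists (- n); lia.
      - by case=> k; rewrite Eb Mo; lia.
      by exists x; split=> // k; have := Hx k; congr (_ | _); rewrite /poly2; ring.
    have [j Hj] : exists j, n * n + n = 2 * j.
      have [j [->|->]] := parity n; first by exists (2 * j * j + j); ring.
      by exists ((2 * j + 1) * (j + 1)); ring.
    have [||x [coh Hx]] := hensel_quadratic 2 (b1 * (2 * i)) (b1 * (1 - 2 * i)) (- n) n prime_2.
    - by exists (b1 * i * n * n + b * n - b1 * i * n); rewrite Eb; lia.
    - by case=> k; rewrite Eb; lia.
    exists x; split=> // k; have [c Hc] := Hx k; exists (2 * c).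
    by rewrite -Z.mul_assoc -Hc Me /poly2; ring.
  have pM : (p | M) by apply: NNPP => pM; apply: ncp; split=> //; left.
  have [i Ei] := pM.
  have p3 := prime_ge_2 p pp.
  have ps : ~ (p | b1 * (2 - M)).
    apply: prime_not_divide_mul => // [[j Hj]].
    have : (p | 2) by exists (j + i); lia.
    by move=> /Z.divide_pos_le; lia.
  have [u [j Hu]] := prime_inverse _ _ pp ps.
  have [||x [coh Hx]] := hensel_quadratic p (b1 * M) (b1 * (2 - M)) (- 2 * n) (2 * u * n) pp.
  - exists (b1 * i * (2 * u * n) * (2 * u * n) + 2 * n * j).
    have -> : b1 * (2 - M) * (2 * u * n) = 2 * n * (u * (b1 * (2 - M))) by ring.
    have -> : u * (b1 * (2 - M)) = j * p + 1 by lia.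
    by rewrite Ei; ring.
  - case=> k Hk; apply: ps; exists (k - 2 * b1 * i * (2 * u * n)).
    have EM : b1 * M * u * n = b1 * i * u * n * p by rewrite {1}Ei; ring.
    by lia.
  by exists x; split=> // k; have := Hx k; congr (_ | _); rewrite /poly2; ring.
exists x, (fun _ => 0), (fun _ => 0).
split=> //; split; first exact: coherent_const; split; first exact: coherent_const.
by move=> k; have := Hx k; congr (_ | _); rewrite /form2 /poly2; ring.
Qed.

(** Without a common factor some coefficient is a unit at each prime, as [loc_sol_unconstrained]
    requires. *)
Lemma gcd3_split a1 a2 a3 : 0 < a1 -> 0 < a2 -> 0 < a3 ->
  exists g b1 b2 b3, 0 < g /\ a1 = g * b1 /\ a2 = g * b2 /\ a3 = g * b3 /\
    forall p, prime p -> ~ ((p | b1) /\ (p | b2) /\ (p | b3)).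
Proof.
move=> a10 a20 a30; pose g := Z.gcd (Z.gcd a1 a2) a3.
have g12 := Z.gcd_divide_l (Z.gcd a1 a2) a3; have [b3 E3] := Z.gcd_divide_r (Z.gcd a1 a2) a3.
have [b1 E1] := Z.divide_trans _ _ _ g12 (Z.gcd_divide_l a1 a2).
have [b2 E2] := Z.divide_trans _ _ _ g12 (Z.gcd_divide_r a1 a2).
rewrite -/g in E1 E2 E3.
have g0 : 0 < g.
  have := Z.gcd_nonneg (Z.gcd a1 a2) a3; rewrite -/g.
  have : g <> 0 by move=> E; rewrite E in E1; lia.
  lia.
exists g, b1, b2, b3; split=> //; split; first lia; split; first lia; split; first lia.
move=> p pp [[c1 C1] [[c2 C2] [c3 C3]]].
have : (p * g | g).
  apply: Z.gcd_greatest; first apply: Z.gcd_greatest.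
  - by exists c1; rewrite E1 C1; ring.
  - by exists c2; rewrite E2 C2; ring.
  - by exists c3; rewrite E3 C3; ring.
have := prime_ge_2 p pp; move=> p2 /Z.divide_pos_le; nia.
Qed.

Lemma twoPm_poly2 m x : twoPm m x = poly2 (m - 2) (2 - (m - 2)) x.
Proof. by rewrite /twoPm /poly2; ring. Qed.

Lemma regular_shifted m a1 a2 a3 : 3 <= m -> 0 < a1 -> 0 < a2 -> 0 < a3 -> regular m a1 a2 a3 ->
  exists b1 b2 b3, 0 < b1 /\ 0 < b2 /\ 0 < b3 /\
    shifted_regular (m - 2) b1 (2 - (m - 2)) b2 (2 - (m - 2)) b3 (2 - (m - 2)).
Proof.
move=> m3 a10 a20 a30 H; have [g [b1 [b2 [b3 [g0 [E1 [E2 [E3 Hg]]]]]]]] := gcd3_split a1 a2 a3 a10 a20 a30.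
set M := m - 2.
exists b1, b2, b3; do 3 (split; first nia); move=> n n0 L.
have M0 : 0 < M by rewrite /M; lia.
have all_loc p : prime p -> loc_sol p M b1 (2 - M) b2 (2 - M) b3 (2 - M) n.
  move=> pp; case: (classic (constraining M p)) => [/L //|cp].
  case: (classic (p | b1)) => p1; last exact: loc_sol_unconstrained.
  case: (classic (p | b2)) => p2.
    apply: loc_sol_swap23; apply: loc_sol_swap12; apply: loc_sol_unconstrained => // p3.
    by apply: (Hg p pp).
  by apply: loc_sol_swap12; apply: loc_sol_unconstrained.
have [||x1 [x2 [x3 E]]] := H (g * n); first nia.
  split; last by apply: real_solvable_nonneg => //; nia.
  move=> p /all_loc[x1 [x2 [x3 [C1 [C2 [C3 Hk]]]]]]; exists x1, x2, x3.
  do 3 (split=> //); move=> k; have [c Hc] := Hk k; exists (g * c).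
  have -> : g * c * p ^ Z.of_nat k = g * (c * p ^ Z.of_nat k) by ring.
  by rewrite -Hc !twoPm_poly2 -/M E1 E2 E3 /form2; ring.
exists x1, x2, x3.
have half x : poly2 M (2 - M) x = 2 * Pm m x.
  have [j Hj] := poly2_even M (2 - M) x ltac:(by exists 1; lia).
  have := twoPm_poly2 m x; rewrite -/M Hj /twoPm /Pm => ->.
  by rewrite Z.mul_comm Z.div_mul; lia.
apply: (Z.mul_reg_l _ _ g); first lia.
by move: E; rewrite /gonal_form /form2 !half E1 E2 E3; lia.
Qed.

Lemma reduced_form m : 3 <= m -> exists_regular_ternary m ->
  exists a1 s1 a2 s2 a3 s3, 0 < a1 <= a2 /\ a2 <= a3 /\
    admissible (m - 2) s1 /\ admissible (m - 2) s2 /\ admissible (m - 2) s3 /\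
    shifted_regular (m - 2) a1 s1 a2 s2 a3 s3 /\ pairwise_prime_to (m - 2) a1 a2 a3.
Proof.
move=> m3 [c1 [c2 [c3 [c10 [c20 [c30 Hreg]]]]]].
have [b1 [b2 [b3 [b10 [b20 [b30 Hb]]]]]] := regular_shifted m c1 c2 c3 m3 c10 c20 c30 Hreg.
set M := m - 2 in Hb *; have M0 : 0 < M by rewrite /M; lia.
have As : admissible M (2 - M).
  split; first lia; split; first by exists 1; lia.
  by move=> M4; exists (- (M / 4)); zdiv_lia.
have [a1 [s1 [a2 [s2 [a3 [s3 [H1 [H2 [H3 [A1 [A2 [A3 [H P]]]]]]]]]]]]] :=
  descent M _ _ _ _ _ _ M0 b10 b20 b30 As As As Hb.
pose ok a1 s1 a2 s2 a3 s3 := 0 < a1 /\ 0 < a2 /\ 0 < a3 /\ admissible M s1 /\ admissible M s2 /\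
  admissible M s3 /\ shifted_regular M a1 s1 a2 s2 a3 s3 /\ pairwise_prime_to M a1 a2 a3.
have ok12 u1 v1 u2 v2 u3 v3 : ok u1 v1 u2 v2 u3 v3 -> ok u2 v2 u1 v1 u3 v3.
  move=> [? [? [? [? [? [? [/shifted_regular_swap12 ? Q]]]]]]].
  by do 7 (split=> //); move=> p /Q; tauto.
have ok23 u1 v1 u2 v2 u3 v3 : ok u1 v1 u2 v2 u3 v3 -> ok u1 v1 u3 v3 u2 v2.
  move=> [? [? [? [? [? [? [/shifted_regular_swap23 ? Q]]]]]]].
  by do 7 (split=> //); move=> p /Q; tauto.
have {H1 H2 H3 A1 A2 A3 H P} : ok a1 s1 a2 s2 a3 s3 by [].
have fin u1 v1 u2 v2 u3 v3 : u1 <= u2 -> u2 <= u3 -> ok u1 v1 u2 v2 u3 v3 ->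
  exists a1 s1 a2 s2 a3 s3, 0 < a1 <= a2 /\ a2 <= a3 /\
    admissible M s1 /\ admissible M s2 /\ admissible M s3 /\
    shifted_regular M a1 s1 a2 s2 a3 s3 /\ pairwise_prime_to M a1 a2 a3.
  by move=> L1 L2 [? [? [? ?]]]; exists u1, v1, u2, v2, u3, v3.
case: (Z.le_gt_cases a1 a2) => L12; case: (Z.le_gt_cases a2 a3) => L23;
  case: (Z.le_gt_cases a1 a3) => L13 K; try lia.
- exact: fin K.
- by apply: fin (ok23 _ _ _ _ _ _ K); lia.
- by apply: fin (ok12 _ _ _ _ _ _ (ok23 _ _ _ _ _ _ K)); lia.
- by apply: fin (ok12 _ _ _ _ _ _ K); lia.
- by apply: fin (ok23 _ _ _ _ _ _ (ok12 _ _ _ _ _ _ K)); lia.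
by apply: fin (ok12 _ _ _ _ _ _ (ok23 _ _ _ _ _ _ (ok12 _ _ _ _ _ _ K))); lia.
Qed.

(** * Sieves by residue classes *)

From mathcomp Require Import all_boot all_algebra all_field zify ssrZ.
Import GRing.Theory.
Delimit Scope Z_scope with Z.
Set Implicit Arguments.
Unset Strict Implicit.
Unset Printing Implicit Defensive.
Local Open Scope nat_scope.

Section ExponentialSums.
Local Open Scope ring_scope.
Variable F : fieldType.

Definition expsum (s : seq (F * F)) (n : nat) : F := \sum_(x <- s) x.1 * x.2 ^+ n.

(** The sequence E(n + 1) - w E(n) no longer contains the base w, and it vanishes at one place
    less. *)
Lemma expsum_vanish s :
  (forall n, (n < size s)%N -> expsum s n = 0) -> forall n, expsum s n = 0.
Proof.
have [k] := ubnP (size s); elim: k s => // k IH [|[c w] s] /= Hk H0 n.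
  by rewrite /expsum big_nil.
have E m : expsum ((c, w) :: s) m = c * w ^+ m + expsum s m.
  by rewrite /expsum big_cons.
set s' := [seq (x.1 * (x.2 - w), x.2) | x <- s].
have E' m : expsum s' m = expsum ((c, w) :: s) m.+1 - w * expsum ((c, w) :: s) m.
  rewrite !E exprS mulrDr opprD addrACA [w * (c * _)]mulrCA subrr add0r.
  rewrite /expsum big_map /= big_distrr /= -sumrB; apply: eq_bigr => x _ /=.
  by rewrite exprS mulrBr mulrBl [x.1 * w]mulrC -!mulrA.
have Z' m : expsum s' m = 0.
  apply: IH; first by rewrite size_map.
  by move=> j; rewrite size_map => Hj; rewrite E' !H0 ?mulr0 ?subr0 //= ltnW.
elim: n => [|n IHn]; first exact: H0.
by have := E' n; rewrite Z' IHn mulr0 subr0.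
Qed.

Lemma expsum_mul s c w n :
  expsum s n * (1 - c * w ^+ n) =
  expsum (s ++ [seq (- (c * x.1), w * x.2) | x <- s]) n.
Proof.
rewrite /expsum big_cat big_map /= mulrBr mulr1; congr (_ + _).
rewrite big_distrl /= -sumrN; apply: eq_bigr => x _ /=.
rewrite mulNr exprMn; congr (- _).
by rewrite mulrACA [x.1 * c]mulrC [x.2 ^+ n * _]mulrC.
Qed.
End ExponentialSums.

(* Crittenden and Vanden Eynden: with zeta_i of order p_i, the product of the
   1 - zeta_i ^ (t - r_i) is a sum of 2 ^ k exponentials in t, so it vanishes
   identically as soon as it vanishes at 2 ^ k consecutive t. *)
Lemma missed_class_bound (l : seq (nat * nat)) :
  all (fun c => 0 < c.1) l ->
  (exists t, ~~ has (fun c => t == c.2 %[mod c.1]) l) ->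
  exists2 t, t < 2 ^ size l & ~~ has (fun c => t == c.2 %[mod c.1]) l.
Proof.
move=> l_gt0 [t0 Ht0].
have [s Ss Es] : exists2 s : seq (algC * algC), size s = 2 ^ size l &
    forall t, (expsum s t == 0%R) = has (fun c => t == c.2 %[mod c.1]) l.
  elim: l l_gt0 {t0 Ht0} => [_|[p r] l IH /= /andP[p0 l0]].
    exists [:: (1%R, 1%R)] => // t.
    by rewrite /expsum big_seq1 /= expr1n mulr1 oner_eq0.
  have [s Ss Es] := IH l0; have [z Hz] := C_prim_root_exists p0.
  exists (s ++ [seq (- ((z ^+ r)^-1 * x.1), z * x.2)%R | x <- s]).
    by rewrite size_cat size_map Ss expnS mul2n addnn.
  move=> t; rewrite -expsum_mul mulf_eq0 Es orbC; congr (_ || _).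
  have zr0 : (z ^+ r != 0)%R by rewrite expf_neq0 //; apply/eqP => z0; move: (prim_expr_order Hz) p0; rewrite z0 expr0n; case: (p) => //= k /eqP; rewrite eq_sym oner_eq0.
  rewrite subr_eq0 eq_sym -(inj_eq (mulfI zr0)) mulr1 mulrA mulfV // mul1r.
  by rewrite (eq_prim_root_expr Hz).
have [/hasP[t] | /hasPn H] := boolP (has (fun t => expsum s t != 0%R) (iota 0 (2 ^ size l))).
  by rewrite mem_iota /= add0n => ht; rewrite Es; exists t.
have Z : forall t, expsum s t = 0%R.
  apply: expsum_vanish => n; rewrite Ss => Hn.
  by apply/eqP; rewrite -[_ == _]negbK H // mem_iota.
by move: Ht0; rewrite -Es Z eqxx.
Qed.

(** Expresses at most one bad class without naming it: p may also have no bad t. *)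
Definition one_class (bad : nat -> nat -> bool) p :=
  forall t u, bad p t -> bad p u = (u == t %[mod p]).

Definition survivors (bad : nat -> nat -> bool) (l : seq nat) X :=
  [seq t <- iota 0 X | all (fun p => ~~ bad p t) l].

Lemma count_class bad p X : 0 < p -> one_class bad p ->
  count (bad p) (iota 0 X) <= (X + p.-1) %/ p.
Proof.
move=> p0 Hb; rewrite -size_filter -(size_map (fun t => t %/ p)).
rewrite -[leqRHS](size_iota 0).
apply: uniq_leq_size.
  rewrite map_inj_in_uniq ?filter_uniq ?iota_uniq // => t u.
  rewrite !mem_filter => /andP[Ht _] /andP[Hu _] E.
  by rewrite (divn_eq t p) (divn_eq u p) E; congr (_ + _); apply/eqP; rewrite eq_sym -(Hb _ _ Ht).
move=> x /mapP[t]; rewrite mem_filter mem_iota => /andP[_ /andP[_ Ht]] -> {x}.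
by rewrite mem_iota leq0n add0n ltn_divLR // ; nia.
Qed.

Lemma survivors_union bad l X : {in l, forall p, 0 < p /\ one_class bad p} ->
  X <= size (survivors bad l X) + \sum_(p <- l) (X + p.-1) %/ p.
Proof.
elim: l => [|p l IH] Hl.
  by rewrite /survivors filter_predT size_iota big_nil addn0.
have [p0 Hp] := Hl p (mem_head _ _).
have /IH : {in l, forall q, 0 < q /\ one_class bad q}.
  by move=> q Hq; apply: Hl; rewrite inE Hq orbT.
rewrite big_cons; have := count_class X p0 Hp; rewrite /survivors !size_filter => C1 C2.
have : count (fun t => all (fun q => ~~ bad q t) l) (iota 0 X) <=
  count (fun t => all (fun q => ~~ bad q t) (p :: l)) (iota 0 X) + count (bad p) (iota 0 X).
  rewrite -count_predUI; apply: leq_trans (leq_addr _ _); apply: sub_count => t /= ->.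
  by case: (bad p t).
lia.
Qed.

(** Let P be the product of the other primes. Among the p lifts t + P j of a survivor t < P, at most
    one is bad for p, by the Chinese remainder theorem. *)
Lemma survivors_period bad l : uniq l -> all prime l ->
  {in l, forall p, forall t u, u = t %[mod p] -> bad p u = bad p t} ->
  {in l, forall p, one_class bad p} ->
  \prod_(p <- l) p.-1 <= size (survivors bad l (\prod_(p <- l) p)).
Proof.
elim: l => [|p l IH] /=; first by rewrite !big_nil.
case/andP=> pl Ul /andP[pp Pl] Hper Hone.
have {}IH : \prod_(q <- l) q.-1 <= size (survivors bad l (\prod_(q <- l) q)).
  by apply: IH => // q Hq; [apply: Hper | apply: Hone]; rewrite inE Hq orbT.
rewrite !big_cons; set P := \prod_(q <- l) q in IH *.
have cPp : coprime P p.
  rewrite coprime_sym /P big_seq; apply: (big_ind (coprime p)) => [|x y|q Hq]; first exact: coprimen1.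
    by rewrite coprimeMr => -> ->.
  rewrite prime_coprime // (dvdn_prime2 pp (allP Pl _ Hq)).
  by apply: contraNneq pl => ->.
have P0 : 0 < P by rewrite /P big_seq prodn_cond_gt0 // => r /(allP Pl) /prime_gt0.
have p0 := prime_gt0 pp.
have Hp := Hone p (mem_head _ _).
pose S := [seq t + P * j | t <- survivors bad l P, j <- [seq j <- iota 0 p | ~~ bad p (t + P * j)]].
apply: (@leq_trans (size S)).
  rewrite size_allpairs_dep sumnE big_map.
  apply: (@leq_trans (\sum_(t <- survivors bad l P) p.-1)).
    by rewrite big_const_seq count_predT iter_addn_0 leq_mul2l IH orbT.
  apply: leq_sum => t _; rewrite size_filter.
  have Hc : count (fun j => bad p (t + P * j)) (iota 0 p) +
            count (fun j => ~~ bad p (t + P * j)) (iota 0 p) = p.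
    by rewrite -[RHS](size_iota 0); exact: count_predC.
  suff : count (fun j => bad p (t + P * j)) (iota 0 p) <= 1 by move: Hc p0; clear; lia.
  move=> {Hc}.
  rewrite -size_filter; case E : [seq j <- _ | _] => [|i [|j r]] //=.
  have Hin k : k \in [:: i, j & r] -> bad p (t + P * k) /\ k < p.
    by rewrite -E mem_filter mem_iota /= add0n => /andP[-> ->].
  have [bi ip] := Hin i (mem_head _ _).
  have /Hin[bj jp] : j \in [:: i, j & r] by rewrite !inE eqxx orbT.
  have : uniq [:: i, j & r] by rewrite -E filter_uniq // iota_uniq.
  rewrite /= inE negb_or => /andP[/andP[/eqP ij _] _]; case: ij.
  move: bj; rewrite (Hp _ _ bi) eqn_modDl => H.
  wlog le : i j ip jp H {E Hin bi} / i <= j.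
    by case: (leqP i j) => [le|/ltnW le] W; [exact: W le|symmetry; apply: W le; rewrite // eq_sym].
  move: H; rewrite eqn_mod_dvd ?leq_mul2l ?le ?orbT // -mulnBr Gauss_dvdr 1?coprime_sym //.
  move=> /dvdn_leq; lia.
apply: uniq_leq_size.
  apply: allpairs_uniq_dep; first by rewrite filter_uniq ?iota_uniq.
    by move=> t _; rewrite filter_uniq ?iota_uniq.
  move=> [t j] [u k] /allpairsPdep[t1 [j1 [Ht1 Hj1 [-> ->]]]].
  move=> /allpairsPdep[u1 [k1 [Hu1 Hk1 [-> ->]]]] /= E.
  move: Ht1 Hu1; rewrite !mem_filter !mem_iota /= !add0n => /andP[_ Ht] /andP[_ Hu].
  have Etu : t1 = u1.
    by have := congr1 (fun x => x %% P) E; rewrite /= ![_ + P * _]addnC ![P * _]mulnC !modnMDl !modn_small.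
  by move: E; rewrite Etu => /addnI/eqP; rewrite eqn_pmul2l // => /eqP ->.
move=> x /allpairsPdep[t [j [Ht Hj ->]]].
move: Ht Hj; rewrite !mem_filter !mem_iota /= !add0n => /andP[Ht tP] /andP[-> jp] /=.
apply/andP; split; last by nia.
apply/allP => q Hq; rewrite (Hper q _ t) ?(allP Ht) ?inE ?Hq ?orbT //.
by rewrite addnC /P (big_rem q Hq) /= -mulnA mulnC modnMDl.
Qed.

(** * Explicit estimates for sieves by primes above 4 *)

Arguments Z.mul : simpl never.
Arguments Z.add : simpl never.
Arguments Z.sub : simpl never.
Arguments Z.pow : simpl never.
Arguments Z.of_nat : simpl never.

Definition sieving (l : seq nat) :=
  sorted ltn l && all (fun p => prime p && (4 < p)) l.

(* 5, 7, 11, 13, 17, 19, 23, 25, ...: the integers > 4 coprime to 6 *)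
Definition wheel i := 3 * i + 5 - odd i.

Lemma coprime6_prime p : prime p -> 4 < p -> p %% 2 != 0 /\ p %% 3 != 0.
Proof.
move=> pp p4; split; apply/negP; rewrite -/(dvdn _ p) dvdn_prime2 //; lia.
Qed.

Lemma wheel_le_nth l i : sieving l -> i < size l -> wheel i <= nth 0 l i.
Proof.
case/andP=> sl /allP pl; elim: i => [|i IH] il.
  by have /pl/andP[_] := mem_nth 0 il.
have {}IH := IH (ltnW il).
have lt : nth 0 l i < nth 0 l i.+1.
  by apply: (sorted_ltn_nth ltn_trans 0 sl); rewrite // inE ltnW.
have /andP[pp p4] := pl _ (mem_nth 0 il).
have [] := coprime6_prime pp p4.
move: IH lt p4; rewrite /wheel; set x := nth 0 l i; set y := nth 0 l i.+1; lia.
Qed.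

Lemma leq_ceil_div X p q : 0 < p -> p <= q -> (X + q.-1) %/ q <= (X + p.-1) %/ p.
Proof.
move=> p0 pq; rewrite leq_divRL //.
case: X => [|X]; first by rewrite add0n divn_small ?ltn_predL //; lia.
have E : X.+1 + q.-1 = X + q by lia.
have q0 : 0 < q by lia.
by rewrite E divnDr ?dvdnn // divnn q0 addn1 mulSn; have := leq_divM X q; nia.
Qed.

(** The union bound in its worst case: the i-th prime is at least [wheel i], hence excludes at most
    the ceiling of X / wheel i elements. The result may be negative. *)
Definition surv R X : Z := foldr
  (fun i a => a - (Z.of_nat X + Z.of_nat (wheel i) - 1) / Z.of_nat (wheel i))%Z
  (Z.of_nat X) (iota 0 R).

Lemma sieving_pos l p : sieving l -> p \in l -> 0 < p.
Proof. by case/andP=> _ /allP H /H /andP[_]; lia. Qed.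

Lemma survivors_wheel bad l X : sieving l -> {in l, forall p, one_class bad p} ->
  (surv (size l) X <= Z.of_nat (size (survivors bad l X)))%Z.
Proof.
move=> sl Hl.
have -> : surv (size l) X =
    (Z.of_nat X - Z.of_nat (\sum_(0 <= i < size l) (X + (wheel i).-1) %/ wheel i))%Z.
  rewrite /surv /index_iota subn0; elim: (iota 0 _) => [|i r IH]; first by rewrite big_nil /=; lia.
  rewrite big_cons /= IH.
  have : 0 < wheel i by rewrite /wheel; lia.
  move: (wheel i) => w w0.
  have -> : (Z.of_nat X + Z.of_nat w - 1 = Z.of_nat (X + w.-1))%Z by lia.
  move: (X + w.-1) => y.
  rewrite -(Z.div_unique_pos (Z.of_nat y) (Z.of_nat w) (Z.of_nat (y %/ w)) (Z.of_nat (y %% w))).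
  - lia.
  - have := ltn_pmod y w0; lia.
  - by rewrite {1}(divn_eq y w); lia.
have U := survivors_union (l := l) (bad := bad) X (fun p pl => conj (sieving_pos sl pl) (Hl p pl)).
have le : \sum_(p <- l) (X + p.-1) %/ p <= \sum_(0 <= i < size l) (X + (wheel i).-1) %/ wheel i.
  rewrite [leqLHS](big_nth 0) big_nat [leqRHS]big_nat; apply: leq_sum => i /= il.
  apply: leq_ceil_div; last exact: wheel_le_nth.
  by rewrite /wheel; lia.
move: (leq_trans U (leq_add (leqnn _) le)); move: (\sum_(0 <= i < _) _) => s.
move: (size _) => n; lia.
Qed.

Definition prodZ (l : seq nat) : Z := foldr (fun p a => (Z.of_nat p * a)%Z) 1%Z l.

Lemma prodZ_prod l : prodZ l = Z.of_nat (\prod_(p <- l) p).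
Proof. by elim: l => [|p l IH]; rewrite ?big_nil // big_cons /= IH; lia. Qed.

Lemma prodZ_cat l k : prodZ (l ++ k) = (prodZ l * prodZ k)%Z.
Proof. by rewrite !prodZ_prod big_cat /=; lia. Qed.

Lemma prodZ_pos l : all (fun p => 0 < p) l -> (0 < prodZ l)%Z.
Proof. by elim: l => //= p l IH /andP[p0 /IH]; nia. Qed.

Lemma leq_prodZ l k : size l = size k -> all (fun p => 0 < p) l ->
  (forall i, i < size l -> nth 0 l i <= nth 0 k i) -> (prodZ l <= prodZ k)%Z.
Proof.
elim: l k => [|p l IH] [|q k] //= [Es] /andP[p0 l0] H.
have := H 0 isT; have := prodZ_pos l0.
have := IH k Es l0 (fun i Hi => H i.+1 Hi); rewrite /=; nia.
Qed.

Definition wheel_prod a n := prodZ [seq wheel i | i <- iota a n].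

Lemma wheel_prod_le l k : sieving l -> (wheel_prod k (size l - k) <= prodZ (drop k l))%Z.
Proof.
move=> sl; apply: leq_prodZ.
- by rewrite size_map size_iota size_drop.
- by apply/allP => x /mapP[i _ ->]; rewrite /wheel; lia.
move=> i; rewrite size_map size_iota => il.
rewrite (nth_map 0) ?size_iota // nth_iota // nth_drop.
by apply: wheel_le_nth => //; lia.
Qed.

Lemma wheel_prodS a n : wheel_prod a n.+1 = (wheel_prod a n * Z.of_nat (wheel (a + n)))%Z.
Proof.
by rewrite /wheel_prod -addn1 iotaD map_cat prodZ_cat /prodZ /= Z.mul_1_r.
Qed.

Definition predprodZ (l : seq nat) : Z := foldr (fun p a => (Z.of_nat p.-1 * a)%Z) 1%Z l.

Lemma predprodZ_prod l : predprodZ l = Z.of_nat (\prod_(p <- l) p.-1).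
Proof. by elim: l => [|p l IH]; rewrite ?big_nil // big_cons /= IH; lia. Qed.

(** The factor 1 - 1/p increases with p. *)
Lemma predprodZ_ratio l k : size l = size k -> all (fun p => 0 < p) l ->
  (forall i, i < size l -> nth 0 l i <= nth 0 k i) ->
  (predprodZ l * prodZ k <= predprodZ k * prodZ l)%Z.
Proof.
elim: l k => [|p l IH] [|q k] //= [Es] /andP[p0 l0] H.
have := H 0 isT; rewrite /= => pq.
have {}IH := IH k Es l0 (fun i Hi => H i.+1 Hi).
have A : (0 <= predprodZ l * prodZ k)%Z by rewrite predprodZ_prod prodZ_prod; lia.
have B : (0 <= predprodZ k * prodZ l)%Z by rewrite predprodZ_prod prodZ_prod; lia.
have C : (Z.of_nat p.-1 * Z.of_nat q <= Z.of_nat q.-1 * Z.of_nat p)%Z.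
  have -> : (Z.of_nat p.-1 = Z.of_nat p - 1)%Z by lia.
  have -> : (Z.of_nat q.-1 = Z.of_nat q - 1)%Z by lia.
  nia.
have -> : (Z.of_nat p.-1 * predprodZ l * (Z.of_nat q * prodZ k) =
  (Z.of_nat p.-1 * Z.of_nat q) * (predprodZ l * prodZ k))%Z by ring.
have -> : (Z.of_nat q.-1 * predprodZ k * (Z.of_nat p * prodZ l) =
  (Z.of_nat q.-1 * Z.of_nat p) * (predprodZ k * prodZ l))%Z by ring.
apply: Z.mul_le_mono_nonneg => //; apply: Z.mul_nonneg_nonneg; lia.
Qed.

Lemma wheel_ratio l : sieving l ->
  (predprodZ [seq wheel i | i <- iota 0 (size l)] * prodZ l <=
   predprodZ l * wheel_prod 0 (size l))%Z.
Proof.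
move=> sl; apply: predprodZ_ratio; first by rewrite size_map size_iota.
  by apply/allP => x /mapP[i _ ->]; rewrite /wheel; lia.
move=> i; rewrite size_map size_iota => il.
by rewrite (nth_map 0) ?size_iota // nth_iota //; apply: wheel_le_nth.
Qed.

(* (1 - 1/5)(1 - 1/6)...(1 - 1/(n+4)) = 4/(n+4) *)
Lemma predprodZ_lower l : sieving l ->
  (4 * prodZ l <= Z.of_nat (size l + 4) * predprodZ l)%Z.
Proof.
move=> sl.
have := @predprodZ_ratio [seq i + 5 | i <- iota 0 (size l)] l.
rewrite size_map size_iota => /(_ erefl) /=.
have P0 : all (fun p => 0 < p) [seq i + 5 | i <- iota 0 (size l)].
  by apply/allP => x /mapP[i _ ->]; lia.
have Hn i : i < size l -> nth 0 [seq i + 5 | i <- iota 0 (size l)] i <= nth 0 l i.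
  move=> il; rewrite (nth_map 0) ?size_iota // nth_iota //.
  by have := wheel_le_nth sl il; rewrite /wheel; lia.
move=> /(_ P0 Hn).
pose sh n := [seq i + 5 | i <- iota 0 n].
have E n : (Z.of_nat (n + 4) * predprodZ (sh n) =
            4 * prodZ (sh n))%Z.
  elim: n => [|n IH] //.
  have C (f : nat -> nat) a b : foldr (fun p a => (Z.of_nat (f p) * a)%Z) 1%Z (rcons a b) =
    (foldr (fun p a => (Z.of_nat (f p) * a)%Z) 1%Z a * Z.of_nat (f b))%Z.
    by elim: a => [|x a IHa] /=; rewrite ?IHa; ring.
  rewrite /sh -addn1 iotaD map_cat cats1 /predprodZ /prodZ (C predn) (C id).
  rewrite -/(predprodZ _) -/(prodZ _) add0n -/(sh n); lia.
have := E (size l); have := prodZ_pos P0.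
rewrite -/(sh (size l)); set a := prodZ (sh _); set b := predprodZ (sh _).
set n := Z.of_nat _; set x := prodZ l; set y := predprodZ l => a0 nb bx.
have n0 : (0 < n)%Z by rewrite /n; lia.
apply: (Zmult_le_reg_r _ _ a); first lia.
have : (n * (b * x) <= n * (y * a))%Z by apply: Z.mul_le_mono_nonneg_l; lia.
have -> : (n * (b * x) = (n * b) * x)%Z by ring.
rewrite nb; lia.
Qed.

(* At least kappa terms of a class modulo h are below M / 2 in each case of the
   theorem that leads to the step h. *)
Definition step_window (h : Z) (kappa : nat) : Prop :=
  [\/ h = 1%Z /\ kappa = 20, h = 3%Z /\ kappa = 25, h = 4%Z /\ kappa = 25 |
      h = 12%Z /\ kappa = 30].

(** Four numerical reasons to conclude for R bad primes. Below M / 2 each variable contributes 0 or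
    one other value: 9 survivors are too many, and windows X2, X3, X5 with 2, 3, 5 survivors give a1
    < h X2, a2 < h X3, a3 < h X5. [Small_product] then makes a1 a2 a3 smaller than the product of
    the bad primes. The last two cases only exclude a bad prime dividing a1 a2; J is a window in
    which R - 1 primes leave a survivor. *)
Inductive sieve_certificate (h : Z) (kappa R : nat) : Prop :=
| Many_survivors of (9 <= surv R kappa)%Z
| Small_product X2 X3 X5 of
    X2 <= kappa & X3 <= kappa & X5 <= kappa &
    (2 <= surv R X2)%Z & (3 <= surv R X3)%Z & (5 <= surv R X5)%Z &
    (h ^ 3 * Z.of_nat X2 * Z.of_nat X3 * Z.of_nat X5 <= wheel_prod 0 R)%Z
| Small_pair X2 X3 J of 6 < R &
    X2 <= kappa & X3 <= kappa & (2 <= surv R X2)%Z & (3 <= surv R X3)%Z &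
    (1 <= surv R.-1 J)%Z &
    (h ^ 4 * Z.of_nat X2 * Z.of_nat X3 ^ 2 * Z.of_nat J <= wheel_prod 0 R)%Z
| Small_gap J of 6 < R & (1 <= surv R.-1 J)%Z &
    (h ^ 4 * Z.of_nat J ^ 4 <= wheel_prod 3 (R - 3))%Z.

(** The limit is 22 because the reciprocals of the first 21 wheel numbers add up to more than 1, so
    that no window J has [surv 21 J] positive. *)
Lemma sieve_certificateP h kappa R :
  step_window h kappa -> R < 22 ->
  sieve_certificate h kappa R.
Proof.
move=> Hh HR.
(* least windows with at least 2, 3, 5 and 1 survivors *)
pose x2 := nth 0 [:: 2; 3; 4; 5; 7; 9; 10; 13; 17; 19] R.
pose x3 := nth 0 [:: 3; 4; 5; 7; 9; 10; 13; 17; 19; 25] R.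
pose x5 := nth 0 [:: 5; 7; 9; 10; 13; 17; 19; 25; 30] R.
pose j := nth 0 [:: 1; 2; 3; 4; 5; 7; 9; 10; 13; 17; 19; 25; 33; 48; 55; 65; 84;
                    129; 182; 245; 644] R.-1.
have : [|| (9 <=? surv R kappa)%Z,
  [&& x2 <= kappa, x3 <= kappa, x5 <= kappa, (2 <=? surv R x2)%Z, (3 <=? surv R x3)%Z,
      (5 <=? surv R x5)%Z &
      (h ^ 3 * Z.of_nat x2 * Z.of_nat x3 * Z.of_nat x5 <=? wheel_prod 0 R)%Z],
  [&& 6 < R, x2 <= kappa, x3 <= kappa, (2 <=? surv R x2)%Z, (3 <=? surv R x3)%Z,
      (1 <=? surv R.-1 j)%Z &
      (h ^ 4 * Z.of_nat x2 * Z.of_nat x3 ^ 2 * Z.of_nat j <=? wheel_prod 0 R)%Z] |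
  [&& 6 < R, (1 <=? surv R.-1 j)%Z &
      (h ^ 4 * Z.of_nat j ^ 4 <=? wheel_prod 3 (R - 3))%Z]].
  (* Past the end of their tables [x2], [x3] and [x5] are 0, a window without survivors, so the
     alternatives that use them fail. *)
  rewrite /x2 /x3 /x5 /j {x2 x3 x5 j}.  do 22 (case: R HR => [|R] HR; first by case: Hh => -[-> ->]; vm_compute).
  by [].
case/or4P.
- by move/Z.leb_le; apply: Many_survivors.
- by case/and5P => ? ? ? ? /and3P[*]; apply: (@Small_product _ _ _ x2 x3 x5) => //; apply/Z.leb_le.
- by case/and5P => ? ? ? ? /and3P[*]; apply: (@Small_pair _ _ _ x2 x3 j) => //; apply/Z.leb_le.
- by case/and3P => *; apply: (@Small_gap _ _ _ j) => //; apply/Z.leb_le.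
Qed.

(** The inequality of [Small_gap] for the window J = 2^(R-1): one more prime multiplies the left
    side by 16 and the right side by more. *)
Lemma power_lt_wheel_prod h R : (0 < h <= 12)%Z -> 22 <= R ->
  (h ^ 4 * (2 ^ Z.of_nat R.-1) ^ 4 <= wheel_prod 3 (R - 3))%Z.
Proof.
move=> Hh HR; rewrite -(subnK HR); elim: (R - 22) => [|n IH].
  have : (h ^ 4 <= 12 ^ 4)%Z by apply: Z.pow_le_mono_l; lia.
  have -> : (wheel_prod 3 (0 + 22 - 3) =
    wheel_prod 3 19)%Z by [].
  have : (12 ^ 4 * (2 ^ Z.of_nat (0 + 22).-1) ^ 4 <= wheel_prod 3 19)%Z by vm_compute.
  nia.
have -> : n.+1 + 22 - 3 = (n + 22 - 3).+1 by lia.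
rewrite wheel_prodS.
have -> : (2 ^ Z.of_nat (n.+1 + 22).-1 = 2 * 2 ^ Z.of_nat (n + 22).-1)%Z.
  by rewrite -Z.pow_succ_r; [congr Z.pow; lia | lia].
move: IH; set y := (2 ^ Z.of_nat _)%Z; set w := wheel_prod _ _ => IH.
have : (16 <= Z.of_nat (wheel (3 + (n + 22 - 3))))%Z by rewrite /wheel; lia.
move: (Z.of_nat _) => e e16.
rewrite Z.pow_mul_l.
have y0 : (0 <= h ^ 4 * y ^ 4)%Z by apply: Z.mul_nonneg_nonneg; apply: Z.pow_nonneg; rewrite /y; lia.
nia.
Qed.

Lemma wheel_prod_quadratic n : 6 <= n -> (100 * (Z.of_nat n + 4) ^ 2 <= wheel_prod 0 n)%Z.
Proof.
move=> H; rewrite -(subnK H); elim: (n - 6) => [|k IH]; first by vm_compute.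
rewrite addSn wheel_prodS.
have : (17 <= Z.of_nat (wheel (0 + (k + 6))))%Z by rewrite /wheel; lia.
move: IH; set w := wheel_prod _ _; move: (Z.of_nat (wheel _)) => e; nia.
Qed.

(** Tailored to the final bound n < 4608 h^3 (R + 3)^2 32^R, where 4608 * 12^3 = 7962624. *)
Lemma wheel_prod_exponential R : 51 <= R ->
  (8000000 * (Z.of_nat R + 3) ^ 2 * 32 ^ Z.of_nat R <= wheel_prod 0 R)%Z.
Proof.
move=> H; rewrite -(subnK H); elim: (R - 51) => [|k IH].
  by apply/Z.leb_le; vm_compute.
rewrite addSn wheel_prodS Nat2Z.inj_succ Z.pow_succ_r; last lia.
have : (128 <= Z.of_nat (wheel (0 + (k + 51))))%Z by rewrite /wheel; lia.
have : (0 < 32 ^ Z.of_nat (k + 51))%Z by apply: Z.pow_pos_nonneg; lia.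
move: IH; set w := wheel_prod _ _; set y := (32 ^ _)%Z; move: (Z.of_nat (wheel _)) => e.
set n := Z.of_nat _.
have : ((Z.succ n + 3) ^ 2 <= 4 * (n + 3) ^ 2)%Z by rewrite /n; nia.
set a := ((Z.succ n + 3) ^ 2)%Z; set b := ((n + 3) ^ 2)%Z => ab IH y0 e0.
have b0 : (0 <= b)%Z by rewrite /b; nia.
have := Z.mul_le_mono_nonneg_r _ _ y ltac:(lia) ab.
have := Z.mul_nonneg_nonneg _ _ b0 (Z.lt_le_incl _ _ y0).
move: IH; rewrite -Z.mul_assoc; set by_ := (b * y)%Z => IH by0 ab'.
have we : (w * 128 <= w * e)%Z by apply: Z.mul_le_mono_nonneg_l; lia.
apply: Z.le_trans we.
have -> : (8000000 * a * (32 * y) = 256000000 * (a * y))%Z by ring.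
move: ab'; have -> : (4 * b * y = 4 * by_)%Z by rewrite /by_; ring.
lia.
Qed.

(** Over the first R - 1 wheel numbers, the product of the 1 - 1/w is at least 1/4 + 1/wheel(R - 1),
    which is what [counting_bound_small] needs. *)
Lemma wheel_ratio_lower R : 6 < R -> R < 51 ->
  ((Z.of_nat (wheel R.-1) + 4) * wheel_prod 0 R.-1 <=
   4 * Z.of_nat (wheel R.-1) * predprodZ [seq wheel i | i <- iota 0 R.-1])%Z.
Proof.
move=> H6 H51; suff /allP : all (fun R => (Z.of_nat (wheel R.-1) + 4) * wheel_prod 0 R.-1 <=?
   4 * Z.of_nat (wheel R.-1) * predprodZ [seq wheel i | i <- iota 0 R.-1])%Z (iota 7 44).
  by move=> /(_ R); rewrite mem_iota => /(_ _)/Z.leb_le; apply; lia.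
by vm_compute.
Qed.

(** * Sieving affine progressions by primes *)

Lemma dvdn_Zdivide p n : reflect (Z.of_nat p | Z.of_nat n)%Z (p %| n).
Proof.
apply: (iffP idP) => [/dvdnP[k ->]|[k Hk]]; first by exists (Z.of_nat k); lia.
case: p Hk => [|p] Hk; first by have -> : n = 0 by lia.
by apply/dvdnP; exists (Z.to_nat k); nia.
Qed.

Lemma prime_Zprime p : prime p -> Znumtheory.prime (Z.of_nat p).
Proof.
move=> pp; apply/prime_alt; split; first by have := prime_gt1 pp; lia.
move=> n Hn Dn; have : Z.to_nat n %| p by apply/dvdn_Zdivide; rewrite Z2Nat.id //; lia.
by case/primeP: pp => _ H /H /orP[/eqP|/eqP]; lia.
Qed.

Lemma Zprime_prime p : Znumtheory.prime (Z.of_nat p) -> prime p.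
Proof.
move=> pp; have := prime_ge_2 _ pp; move=> p2; apply/primeP; split; first lia.
move=> d /dvdn_Zdivide /(prime_divisors _ pp) H; apply/orP.
by case: (eqVneq d 1) => [->|d1]; [left | right; apply/eqP; lia].
Qed.

Definition affine_bad (m b : Z) (p t : nat) : bool :=
  ((m * Z.of_nat t + b) mod Z.of_nat p =? 0)%Z.

Lemma affine_badP m b p t : 0 < p ->
  reflect (Z.of_nat p | m * Z.of_nat t + b)%Z (affine_bad m b p t).
Proof.
move=> p0; apply: (iffP idP) => [/Z.eqb_eq|] H; first by apply/Z.mod_divide; [lia|].
by apply/Z.eqb_eq/Z.mod_divide; [lia|].
Qed.

Lemma eqmod_Zdivide p t u : 0 < p ->
  reflect (Z.of_nat p | Z.of_nat u - Z.of_nat t)%Z (u == t %[mod p]).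
Proof.
move=> p0; wlog le : t u / t <= u => [W|].
  case: (leqP t u) => [/W //|/ltnW /W H]; rewrite eq_sym.
  apply: (iffP H) => -[k Hk]; exists (- k)%Z; lia.
rewrite eqn_mod_dvd //; apply: (iffP (dvdn_Zdivide _ _)); congr (_ | _)%Z; lia.
Qed.

Lemma affine_periodic m b p t u : 0 < p -> u = t %[mod p] -> affine_bad m b p u = affine_bad m b p t.
Proof.
move=> p0 /eqP /(eqmod_Zdivide _ _ p0)[k Hk].
apply/(affine_badP _ _ _ p0)/(affine_badP _ _ _ p0) => -[c Hc].
  by exists (c - m * k)%Z; lia.
by exists (c + m * k)%Z; lia.
Qed.

Lemma affine_one_class m b p : prime p -> ~ (Z.of_nat p | m)%Z -> one_class (affine_bad m b) p.
Proof.
move=> pp pm t u Ht; have p0 := prime_gt0 pp.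
have [c Hc] := affine_badP _ _ _ p0 Ht.
apply/(affine_badP _ _ _ p0)/(eqmod_Zdivide _ _ p0) => [[d Hd]|[k Hk]].
  have : (Z.of_nat p | m * (Z.of_nat u - Z.of_nat t))%Z by exists (d - c)%Z; lia.
  by case/(prime_mult _ (prime_Zprime pp)).
by exists (c + m * k)%Z; lia.
Qed.

Definition covers (cs : seq (nat * nat)) (bad : nat -> nat -> bool) p :=
  all (fun c => 0 < c.1) cs /\ forall t, bad p t = has (fun c => t == c.2 %[mod c.1]) cs.

Lemma sieve_exponential bad m l t0 :
  (forall p, p \in l -> exists2 cs, covers cs bad p & size cs <= m) ->
  all (fun p => ~~ bad p t0) l ->
  exists2 t, t < 2 ^ (m * size l) & all (fun p => ~~ bad p t) l.
Proof.
move=> Hcs Ht0.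
have [cs [cs0 Ecs] Scs] : exists2 cs, all (fun c => 0 < c.1) cs /\
    (forall t, has (fun p => bad p t) l = has (fun c => t == c.2 %[mod c.1]) cs) &
    size cs <= m * size l.
  elim: l Hcs {Ht0} => [|p l IH] Hcs; first by exists [::].
  have [c1 [c10 Ec1] Sc1] := Hcs p (mem_head _ _).
  have [|c2 [c20 Ec2] Sc2] := IH; first by move=> r rl; apply: Hcs; rewrite inE rl orbT.
  exists (c1 ++ c2); last by rewrite size_cat /= mulnS leq_add.
  by split=> [|t]; rewrite ?all_cat ?c10 // has_cat -Ec2 /= Ec1.
have [|t tlt Ht] := missed_class_bound cs0.
  by exists t0; rewrite -Ecs; apply/hasPn => p /(allP Ht0).
exists t; first by apply: leq_trans tlt _; rewrite leq_exp2l.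
by apply/allP => p pl; move: Ht; rewrite -Ecs => /hasPn /(_ p pl).
Qed.

Lemma one_class_covers bad p : 0 < p -> one_class bad p ->
  exists2 cs, covers cs bad p & size cs <= 1.
Proof.
move=> p0 Hb; case E : (has (bad p) (iota 0 p)).
  have /hasP[r _ br] := E; exists [:: (p, r)] => //; split=> /=; first by rewrite p0.
  by move=> t; rewrite orbF (Hb r t br).
exists [::] => //; split=> //= t; apply/negbTE/negP => bt.
move/negbT/hasPn: E => /(_ (t %% p)); rewrite mem_iota /= add0n ltn_pmod // => /(_ isT).
by rewrite (Hb t _ bt) modn_mod eqxx.
Qed.

(** The count over a full period provides one survivor, and the exponential bound then finds one in
    the short window. *)
Lemma sieve_single bad l : uniq l -> all prime l ->
  {in l, forall p, forall t u, u = t %[mod p] -> bad p u = bad p t} ->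
  {in l, forall p, one_class bad p} ->
  exists2 t, t < 2 ^ size l & all (fun p => ~~ bad p t) l.
Proof.
move=> Ul Pl Hper Hone.
have : 0 < size (survivors bad l (\prod_(p <- l) p)).
  apply: leq_trans (survivors_period Ul Pl Hper Hone).
  rewrite big_seq prodn_cond_gt0 // => p /(allP Pl) /prime_gt1; lia.
case E : (survivors _ _ _) => [|t0 r] // _.
have : t0 \in survivors bad l (\prod_(p <- l) p) by rewrite E mem_head.
rewrite mem_filter => /andP[Ht0 _].
have [|t tlt Ht] := @sieve_exponential bad 1 l t0 _ Ht0; last by rewrite mul1n in tlt; exists t.
by move=> p pl; apply: one_class_covers; [exact: prime_gt0 (allP Pl _ pl) | exact: Hone].
Qed.

(* A window of length J contains a survivor of any sieve by r primes > 4. *)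
Definition sieve_gap (r J : nat) := (1 <= surv r J)%Z \/ J = 2 ^ r.

Lemma sieve_gapP l m b J : sieving l -> {in l, forall p, ~ (Z.of_nat p | m)%Z} ->
  sieve_gap (size l) J ->
  exists2 t, t < J & {in l, forall p, ~ (Z.of_nat p | m * Z.of_nat t + b)%Z}.
Proof.
move=> sl Hm HJ.
have Pl : all prime l by case/andP: sl => _ /allP H; apply/allP => p /H /andP[].
have Ul : uniq l by case/andP: sl => s _; apply: sorted_uniq s; [exact: ltn_trans | exact: ltnn].
have Hone : {in l, forall p, one_class (affine_bad m b) p}.
  by move=> p pl; apply: affine_one_class; [exact: (allP Pl) | exact: Hm].
have [t tJ Ht] : exists2 t, t < J & all (fun p => ~~ affine_bad m b p t) l.
  case: HJ => [H1|->].
    have := survivors_wheel (X := J) sl Hone; case E : (survivors _ _ _) => [|t r] /=; first lia.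
    have : t \in survivors (affine_bad m b) l J by rewrite E mem_head.
    by rewrite mem_filter mem_iota add0n => /andP[Ht /andP[_ tJ]]; exists t.
  apply: sieve_single => // p pl t u; apply: affine_periodic.
  exact: prime_gt0 (allP Pl _ pl).
exists t => // p pl; have := allP Ht p pl => /negP H /(affine_badP _ _ _ _) B.
by apply: H; apply: B; exact: prime_gt0 (allP Pl _ pl).
Qed.

(** * Sieving the values of a reduced form *)

Local Open Scope Z_scope.

(* The class n0 mod h takes care of the primes 2 and 3. *)
Record sieved (M : Z) (kappa : nat) (h n0 a1 s1 a2 s2 a3 s3 : Z) : Prop := Sieved {
  sieved_a1 : 0 < a1;
  sieved_a12 : a1 <= a2;
  sieved_a23 : a2 <= a3;
  sieved_s1 : admissible M s1;
  sieved_s2 : admissible M s2;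
  sieved_s3 : admissible M s3;
  sieved_h : step_window h kappa;
  sieved_M : 2 * h * Z.of_nat kappa <= M + 2;
  sieved_n0 : 0 <= n0 < h;
  sieved_pairwise : forall p, Znumtheory.prime p -> 5 <= p -> ~ (p | M) ->
    ~ ((p | a1) /\ (p | a2)) /\ ~ ((p | a1) /\ (p | a3)) /\ ~ ((p | a2) /\ (p | a3));
  sieved_rep : forall n, 0 <= n -> (h | n - n0) ->
    (forall p, Znumtheory.prime p -> 5 <= p -> ~ (p | M) -> (p | a1 * a2 * a3) ->
       ~ (p | square_value M a1 s1 a2 s2 a3 s3 n)) ->
    exists x1 x2 x3, form2 M a1 s1 a2 s2 a3 s3 x1 x2 x3 = 2 * n }.

Definition bad_primes (M A : Z) : list nat :=
  [seq p <- primes (Z.to_nat A) | (4 < p)%N && ~~ (p %| Z.to_nat M)].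

Lemma dvdn_to_nat p n : 0 <= n -> reflect (Z.of_nat p | n) (p %| Z.to_nat n)%N.
Proof. by move=> n0; rewrite -{1}(Z2Nat.id n n0); exact: dvdn_Zdivide. Qed.

Lemma bad_primesP M A p : 0 < M -> 0 < A ->
  reflect [/\ Znumtheory.prime (Z.of_nat p), 5 <= Z.of_nat p, ~ (Z.of_nat p | M) & (Z.of_nat p | A)]
    (p \in bad_primes M A).
Proof.
move=> M0 A0; rewrite mem_filter mem_primes.
have HM := dvdn_to_nat p (Z.lt_le_incl _ _ M0); have HA := dvdn_to_nat p (Z.lt_le_incl _ _ A0).
apply: (iffP and3P) => [[/andP[p4 /HM pM] pp /andP[_ /HA pA]]|[pp p5 pM pA]].
  by split=> //; [exact: prime_Zprime | lia].
split; first by apply/andP; split; [lia | apply/HM].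
  exact: Zprime_prime.
by apply/andP; split; [lia | apply/HA].
Qed.

Lemma sieving_bad_primes M A : sieving (bad_primes M A).
Proof.
apply/andP; split; first by apply: sorted_filter; [exact: ltn_trans | exact: sorted_primes].
by apply/allP => p; rewrite mem_filter mem_primes => /andP[/andP[-> _] /andP[-> _]].
Qed.

Lemma prodZ_divide l A : uniq l -> all prime l -> {in l, forall p, (Z.of_nat p | A)} ->
  (prodZ l | A).
Proof.
elim: l A => [|p l IH] A /=; first by exists A; lia.
case/andP=> pl Ul /andP[pp Pl] H.
have [B EB] := H p (mem_head _ _).
suff [k Hk] : (prodZ l | B) by exists k; rewrite EB Hk; ring.
apply: IH => // q ql.
have qA : (Z.of_nat q | A) by apply: H; rewrite inE ql orbT.
have qq := prime_Zprime (allP Pl _ ql).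
move: qA; rewrite EB => /(prime_mult _ qq)[//|/dvdn_Zdivide].
rewrite (dvdn_prime2 (allP Pl _ ql) pp) => /eqP Eq; by rewrite -Eq ql in pl.
Qed.

Lemma sieving_uniq l : sieving l -> uniq l.
Proof. by case/andP=> s _; apply: sorted_uniq s; [exact: ltn_trans | exact: ltnn]. Qed.

Lemma sieving_prime l p : sieving l -> p \in l -> prime p.
Proof. by case/andP=> _ /allP H /H /andP[]. Qed.

Lemma sieving_filter P l : sieving l -> sieving (filter P l).
Proof.
case/andP=> s /allP H; apply/andP; split; first by apply: sorted_filter => //; exact: ltn_trans.
by apply/allP => p; rewrite mem_filter => /andP[_ /H].
Qed.

Definition centered_range (B : Z) : seq Z :=
  [seq Z.of_nat i - (B + 1) | i <- iota 0 (Z.to_nat (2 * B + 3))].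

Lemma mem_centered_range B x : 0 <= B -> Z.abs x <= B + 1 -> x \in centered_range B.
Proof.
move=> B0 Hx; apply/mapP; exists (Z.to_nat (x + (B + 1))); last lia.
by rewrite mem_iota; lia.
Qed.

(** Since |s| <= M, the value is at least M (x^2 - |x|), hence at least M (|x| - 1)^2 for x nonzero;
    this accounts for the margin 1 in [centered_range]. *)
Lemma poly2_root_bound M a s x Y : 0 < M -> 0 < a -> admissible M s -> a * poly2 M s x <= Y ->
  Z.abs x <= Z.sqrt (Y / (a * M)) + 1.
Proof.
move=> M0 a0 [Hs _] HY; case: (Z.eq_dec x 0) => [->|x0]; first by have := Z.sqrt_nonneg (Y / (a * M)); lia.
suff : Z.abs x - 1 <= Z.sqrt (Y / (a * M)) by lia.
have aM : 0 < a * M by nia.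
apply/Z.sqrt_le_square; [|lia|].
  have := poly2_ge0 M s x Hs => P0; apply: Z.div_pos => //; nia.
apply: Z.div_le_lower_bound => //; apply: Z.le_trans HY.
rewrite -Z.mul_assoc; apply: Z.mul_le_mono_nonneg_l; first lia.
rewrite /poly2; set y := Z.abs x.
have [y1 Hxy] : 1 <= y /\ x * x = y * y by rewrite /y; nia.
have Hsx : - (M * y) <= s * x by rewrite /y; nia.
have : M * ((y - 1) * (y - 1)) <= M * (y * y - y) by apply: Z.mul_le_mono_nonneg_l; nia.
have -> : M * x * x = M * (x * x) by ring.
rewrite Hxy; lia.
Qed.

(* e F >= (e + 4) E / 4 with F / E <= Phi / D is prod (1 - 1/p) - 1/q >= 1/4 *)
Lemma counting_bound_small e E F D Phi q B1 B2 : 0 < e <= q -> 0 < E -> 0 < D ->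
  (e + 4) * E <= 4 * e * F -> F * D <= Phi * E ->
  q * (Phi - (2 * B1 + 3) * (2 * B2 + 3)) <= D + q - 1 ->
  0 <= B1 -> 0 <= B2 -> 19 * (B1 * B1) <= D -> 19 * (B2 * B2) <= D -> D <= 5000.
Proof.
move=> He E0 D0 H1 H2 H3 B10 B20 H4 H5.
have HPhi : (e + 4) * D <= 4 * e * Phi.
  apply: (Zmult_le_reg_r _ _ E); first lia.
  have : (e + 4) * E * D <= 4 * e * F * D by apply: Z.mul_le_mono_nonneg_r; lia.
  have : 4 * e * (F * D) <= 4 * e * (Phi * E) by apply: Z.mul_le_mono_nonneg_l; lia.
  lia.
set S := (2 * B1 + 3) * (2 * B2 + 3) in H3 *.
have HS : D - 4 <= 4 * S.
  apply: (Zmult_le_reg_r _ _ e); first lia.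
  case: (Z.le_gt_cases (Phi - S) 1) => HPS; first by nia.
  have : e * (Phi - S - 1) <= q * (Phi - S - 1) by apply: Z.mul_le_mono_nonneg_r; lia.
  lia.
have [B [B0 [HB HSB]]] : exists B, 0 <= B /\ 19 * (B * B) <= D /\ S <= (2 * B + 3) * (2 * B + 3).
  case: (Z.le_gt_cases B1 B2) => HB; [exists B2 | exists B1]; rewrite /S; (split; [lia | split; [lia | nia]]).
have : B <= 16 by nia.
nia.
Qed.

(** At least Phi - D/q - 1 elements survive, about 3 D / r or more. If x >= 4 r, the main term 4 B1
    B2 of the number of pairs is at most D / r, and the remaining terms are too small to fill the
    gap. *)
Lemma counting_bound_large r q D Phi B1 B2 x : 6 <= r -> r <= q -> 100 * (r * r) <= D ->
  4 * D <= r * Phi ->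
  q * (Phi - (2 * B1 + 3) * (2 * B2 + 3)) <= D + q - 1 ->
  0 <= B1 -> 0 <= B2 -> 19 * (B1 * B1) <= D -> 19 * (B2 * B2) <= D ->
  x * (B1 * B2) <= D -> x < 4 * r.
Proof.
move=> r6 rq HD HPhi H3 B10 B20 H4 H5 Hx.
case: (Z.lt_ge_cases x (4 * r)) => // Hxr.
have HB : 4 * r * (B1 * B2) <= D.
  by apply: Z.le_trans Hx; apply: Z.mul_le_mono_nonneg_r => //; nia.
set S := (2 * B1 + 3) * (2 * B2 + 3) in H3 *.
have HS : 3 * D - r <= r * S.
  case: (Z.le_gt_cases (Phi - S) 1) => HPS; first by nia.
  have : r * (Phi - S - 1) <= q * (Phi - S - 1) by apply: Z.mul_le_mono_nonneg_r; lia.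
  lia.
have HrS : r * S <= D + 6 * (r * B1) + 6 * (r * B2) + 9 * r by rewrite /S; lia.
(* From 4 r B <= 4 r^2 + B^2, multiplied by 1900, with 100 r^2 <= D and 19 B^2 <= D. *)
have K B : 19 * (B * B) <= D -> 7600 * (r * B) <= 176 * D.
  by move=> HB'; have := Z.square_nonneg (2 * r - B); lia.
have := K _ H4; have := K _ H5; have : 6 * r <= r * r by apply: Z.mul_le_mono_nonneg_r; lia.
lia.
Qed.

(** * Contradiction for a sieved form with M large *)

Section Core.
Variables (M : Z) (kappa : nat) (h n0 a1 s1 a2 s2 a3 s3 : Z).
Hypothesis core : sieved M kappa h n0 a1 s1 a2 s2 a3 s3.

Let disc n := square_value M a1 s1 a2 s2 a3 s3 n.
Let l := bad_primes M (a1 * a2 * a3).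
Let R := size l.

Lemma core_pos : [/\ 0 < a1, 0 < a2, 0 < a3, 0 < a1 * a2 * a3 & 0 < h].
Proof.
case: core => H1 H2 H3 _ _ _ _ _ Hn _ _; split; try lia.
by apply: Z.mul_pos_pos; [apply: Z.mul_pos_pos|]; lia.
Qed.

Lemma core_h12 : 0 < h <= 12.
Proof. by case: (sieved_h core) => -[-> _]. Qed.

Lemma core_M : 38 * h <= M.
Proof. by have := sieved_M core; case: (sieved_h core) => -[-> ->]; lia. Qed.

Lemma core_M0 : 0 < M. Proof. by have := core_M; have := core_h12; lia. Qed.

Lemma core_bad p : p \in l ->
  [/\ Znumtheory.prime (Z.of_nat p), 5 <= Z.of_nat p, ~ (Z.of_nat p | M) & (Z.of_nat p | a1 * a2 * a3)].
Proof. by move/bad_primesP; apply; [exact: core_M0 | case: core_pos]. Qed.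

Lemma core_rep n : 0 <= n -> (h | n - n0) -> {in l, forall p, ~ (Z.of_nat p | disc n)} ->
  exists x1 x2 x3, form2 M a1 s1 a2 s2 a3 s3 x1 x2 x3 = 2 * n.
Proof.
move=> n0' nh Hn; apply: (sieved_rep core) => // p pp p5 pM pA.
have Ep : p = Z.of_nat (Z.to_nat p) by lia.
rewrite Ep in pp p5 pM pA *; apply: Hn.
by apply/bad_primesP => //; [exact: core_M0 | case: core_pos].
Qed.

Lemma core_h_coprime p : Znumtheory.prime p -> 5 <= p -> ~ (p | h) /\ ~ (p | 8).
Proof.
have small c : Znumtheory.prime p -> 5 <= p -> 0 < c < 5 -> ~ (p | c).
  by move=> pp p5 Hc /Z.divide_pos_le; lia.
move=> pp p5; split.
  case: (sieved_h core) => -[-> _]; try by apply: small.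
  by have -> : 12 = 3 * 4 by []; apply: prime_not_divide_mul => //; apply: small.
have -> : 8 = 2 * 4 by [].
by apply: prime_not_divide_mul => //; apply: small.
Qed.

Lemma chinese_class q c : ~ (q | h) -> Znumtheory.prime q -> exists2 c0, 0 <= c0 < h * q & (h | c0 - n0) /\ (q | c0 - c).
Proof.
move=> qh qp; have [u [k Hu]] := prime_inverse _ _ qp qh.
have q2 := prime_ge_2 _ qp; have [_ _ _ _ h0] := core_pos.
have hq : 0 < h * q by apply: Z.mul_pos_pos; lia.
pose d := n0 + h * (u * (c - n0)); exists (d mod (h * q)); first exact: Z.mod_pos_bound.
have Ed := Z.div_mod d (h * q) ltac:(lia).
have -> : d mod (h * q) = d - h * q * (d / (h * q)) by lia.
rewrite /d; move: (_ / _) => e; split.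
  by exists (u * (c - n0) - q * e); lia.
exists (k * (c - n0) - h * e).
have -> : n0 + h * (u * (c - n0)) = n0 + (u * h) * (c - n0) by ring.
have -> : u * h = k * q + 1 by lia.
ring.
Qed.

Lemma core_step_ndiv p : p \in l -> ~ (Z.of_nat p | 8 * M * h).
Proof.
move=> /core_bad[pp p5 pM _]; have [ph p8] := core_h_coprime pp p5.
by apply: prime_not_divide_mul => //; apply: prime_not_divide_mul.
Qed.

Lemma disc_shift n m : disc (n + m) = disc n + 8 * M * m.
Proof. by rewrite /disc /square_value; ring. Qed.

(** The class of c deals with p, so only the other R - 1 primes are sieved, along a progression of
    step h p. *)
Lemma rep_in_class p c J : p \in l -> ~ (Z.of_nat p | disc c) -> sieve_gap R.-1 J ->
  exists n x1 x2 x3, [/\ 0 <= n < h * Z.of_nat p * Z.of_nat J, (Z.of_nat p | n - c) &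
    form2 M a1 s1 a2 s2 a3 s3 x1 x2 x3 = 2 * n].
Proof.
move=> pl pc HJ; have [pp p5 pM _] := core_bad pl.
have [ph p8] := core_h_coprime pp p5.
have [c0 Hc0 [hc0 pc0]] := chinese_class c ph pp.
have sl : sieving l := sieving_bad_primes _ _.
have sl' := sieving_filter (predC1 p) sl.
have Sl' : size (filter (predC1 p) l) = R.-1 by rewrite -rem_filter ?sieving_uniq // size_rem.
rewrite -Sl' in HJ.
have [q ql'|t tJ Ht] := @sieve_gapP _ (8 * M * h * Z.of_nat p) (disc c0) J sl' _ HJ.
  move: ql'; rewrite mem_filter => /andP[/= qp ql]; have [qq _ _ _] := core_bad ql.
  apply: prime_not_divide_mul => //; first exact: core_step_ndiv.
  move/dvdn_Zdivide; rewrite dvdn_prime2 ?(sieving_prime sl) //; exact/negP.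
have En : disc (c0 + h * Z.of_nat p * Z.of_nat t) = 8 * M * h * Z.of_nat p * Z.of_nat t + disc c0.
  by rewrite disc_shift; ring.
have Pn : (Z.of_nat p | c0 + h * Z.of_nat p * Z.of_nat t - c).
  by have [k Hk] := pc0; exists (k + h * Z.of_nat t); lia.
have [||q ql|x1 [x2 [x3 Ex]]] := @core_rep (c0 + h * Z.of_nat p * Z.of_nat t).
- by nia.
- by have [k Hk] := hc0; exists (k + Z.of_nat p * Z.of_nat t); lia.
- case: (eqVneq q p) => [->|qp].
    have [k Hk] := Pn => -[d Hd]; apply: pc; exists (d - 8 * M * k).
    have E : c0 + h * Z.of_nat p * Z.of_nat t = c + k * Z.of_nat p by lia.
    by rewrite E disc_shift in Hd; lia.
  by rewrite En; apply: Ht; rewrite mem_filter /= qp.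
exists (c0 + h * Z.of_nat p * Z.of_nat t), x1, x2, x3; split=> //.
have [_ _ _ _ h0] := core_pos.
have : 0 < h * Z.of_nat p by nia.
nia.
Qed.

Lemma poly2_small a s x n : 0 < a -> admissible M s -> n < a -> a * poly2 M s x <= 2 * n -> poly2 M s x = 0.
Proof.
move=> a0 [Hs [Hi _]] na; have := poly2_ge0 M s x Hs; have [j ->] := poly2_even M s x Hi; nia.
Qed.

Lemma below_a3 x1 x2 x3 n : form2 M a1 s1 a2 s2 a3 s3 x1 x2 x3 = 2 * n -> n < a3 -> poly2 M s3 x3 = 0.
Proof.
have [A1 A2 A3 _ _] := core_pos; rewrite /form2 => E n3.
have := poly2_ge0 M s1 x1 (proj1 (sieved_s1 core)); have := poly2_ge0 M s2 x2 (proj1 (sieved_s2 core)) => P2 P1.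
by apply: (@poly2_small a3 s3 x3 n) => //; [exact: sieved_s3 core | nia].
Qed.

Lemma below_a2 x1 x2 x3 n : form2 M a1 s1 a2 s2 a3 s3 x1 x2 x3 = 2 * n -> n < a2 -> poly2 M s2 x2 = 0.
Proof.
have [A1 A2 A3 _ _] := core_pos; rewrite /form2 => E n3.
have := poly2_ge0 M s1 x1 (proj1 (sieved_s1 core)); have := poly2_ge0 M s3 x3 (proj1 (sieved_s3 core)) => P2 P1.
by apply: (@poly2_small a2 s2 x2 n) => //; [exact: sieved_s2 core | nia].
Qed.

Lemma complete_square s x : 4 * M * poly2 M s x + s * s = (2 * M * x + s) * (2 * M * x + s).
Proof. by rewrite /poly2; ring. Qed.

(* Below a2 only a1 x1 contributes: take n in a class modulo p that it avoids. *)
Lemma unary_gap p J : p \in l -> sieve_gap R.-1 J -> a2 < h * Z.of_nat p * Z.of_nat J.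
Proof.
move=> pl HJ; have [pp p5 pM _] := core_bad pl; have [_ p8] := core_h_coprime pp p5.
have p8M : ~ (Z.of_nat p | 8 * M) by exact: prime_not_divide_mul.
(* Modulo p the values of a1 X^2 lie among those of b Z^2 with b a unit; when p divides a1, they are
   0 and b = 1 will do. *)
have [b pb Hb] : exists2 b, ~ (Z.of_nat p | b) & forall X, exists j Z,
    a1 * (X * X) = j * Z.of_nat p + b * (Z * Z).
  case: (classic (Z.of_nat p | a1)) => [[j Hj]|pa1].
    exists 1; first by move/Z.divide_pos_le; lia.
    by move=> X; exists (j * (X * X)), 0; rewrite Hj; ring.
  by exists a1 => // X; exists 0, X; ring.
have [c [Hc1 Hc2]] := nonresidue_class _ (8 * M) b (a1 * (s1 * s1))
  (a1 * (s1 * s1) + a2 * (s2 * s2) + a3 * (s3 * s3)) pp p5 p8M pb.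
have pc : ~ (Z.of_nat p | disc c).
  by move: Hc2; congr (~ (_ | _)); rewrite /disc /square_value; ring.
have [n [x1 [x2 [x3 [Hn [k Hk] Ex]]]]] := rep_in_class pl pc HJ.
case: (Z.le_gt_cases a2 n) => [|na]; first lia.
have n3 : n < a3 by have := sieved_a23 core; lia.
have E3 := below_a3 Ex n3; have E2 := below_a2 Ex na.
move: Ex; rewrite /form2 E2 E3 => Ex.
have [j [Z HZ]] := Hb (2 * M * x1 + s1).
case: (Hc1 Z); exists (j - 8 * M * k).
have -> : c = n - k * Z.of_nat p by lia.
move: HZ; rewrite -!complete_square; lia.
Qed.

(** As p divides only one of a1 and a2, the binary form is a unit times a single square modulo p,
    and a class of nonresidues avoids it. *)
Lemma binary_gap p J : p \in l -> (Z.of_nat p | a1 * a2) -> sieve_gap R.-1 J ->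
  a3 < h * Z.of_nat p * Z.of_nat J.
Proof.
move=> pl p12 HJ; have [pp p5 pM _] := core_bad pl; have [_ p8] := core_h_coprime pp p5.
have p8M : ~ (Z.of_nat p | 8 * M) by exact: prime_not_divide_mul.
have [N12 _] := sieved_pairwise core pp p5 pM.
have [b pb Hb] : exists2 b, ~ (Z.of_nat p | b) & forall X Y, exists j Z,
    a1 * (X * X) + a2 * (Y * Y) = j * Z.of_nat p + b * (Z * Z).
  case/(prime_mult _ pp): p12 => [[j Hj]|[j Hj]].
    exists a2; first by move=> p2; apply: N12; split=> //; exists j.
    by move=> X Y; exists (j * (X * X)), Y; rewrite Hj; ring.
  exists a1; first by move=> p2; apply: N12; split=> //; exists j.
  by move=> X Y; exists (j * (Y * Y)), X; rewrite Hj; ring.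
have [c [Hc1 Hc2]] := nonresidue_class _ (8 * M) b (a1 * (s1 * s1) + a2 * (s2 * s2))
  (a1 * (s1 * s1) + a2 * (s2 * s2) + a3 * (s3 * s3)) pp p5 p8M pb.
have pc : ~ (Z.of_nat p | disc c).
  by move: Hc2; congr (~ (_ | _)); rewrite /disc /square_value; ring.
have [n [x1 [x2 [x3 [Hn [k Hk] Ex]]]]] := rep_in_class pl pc HJ.
case: (Z.le_gt_cases a3 n) => [|na]; first lia.
have E3 := below_a3 Ex na.
move: Ex; rewrite /form2 E3 => Ex.
have [j [Z HZ]] := Hb (2 * M * x1 + s1) (2 * M * x2 + s2).
case: (Hc1 Z); exists (j - 8 * M * k).
have -> : c = n - k * Z.of_nat p by lia.
move: HZ; rewrite -!complete_square; lia.
Qed.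

(** For |x| >= 2 the value of [poly2] is at least 2 M; at 1 and - 1 it is M + s and M - s, and only
    the smaller one can be at most M, unless s = 0. *)
Lemma poly2_values a s x : 0 < a -> admissible M s -> a * poly2 M s x <= M ->
  a * poly2 M s x \in [:: 0; a * (M - Z.abs s)].
Proof.
move=> a0 [Hs _] HM; have M0 := core_M0.
have P0 := poly2_ge0 M s x Hs; have PM : poly2 M s x <= M by nia.
rewrite !inE; apply/orP.
suff [->|->] : poly2 M s x = 0 \/ poly2 M s x = M - Z.abs s.
- by left; rewrite Z.mul_0_r.
- by right.
move: PM; rewrite /poly2.
have [->|[->|[->|[x2|x2]]]] : x = 0 \/ x = 1 \/ x = -1 \/ 2 <= x \/ x <= -2 by lia.
- by left; ring.
- by right; lia.
- by right; lia.
- have : 2 * (M * x + s) <= x * (M * x + s) by apply: Z.mul_le_mono_nonneg_r; nia.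
  nia.
have : 2 * (M * (- x) - s) <= (- x) * (M * (- x) - s) by apply: Z.mul_le_mono_nonneg_r; nia.
nia.
Qed.

Let bad := affine_bad (8 * M * h) (disc n0).

Lemma bad_one_class : {in l, forall p, one_class bad p}.
Proof.
move=> p pl; apply: affine_one_class; last exact: core_step_ndiv.
exact: sieving_prime (sieving_bad_primes _ _) pl.
Qed.

Lemma survivor_rep t : all (fun p => ~~ bad p t) l ->
  exists x1 x2 x3, form2 M a1 s1 a2 s2 a3 s3 x1 x2 x3 = 2 * (n0 + h * Z.of_nat t).
Proof.
move=> Ht; have [_ _ _ _ h0] := core_pos.
apply: core_rep; first by have := sieved_n0 core; nia.
  by exists (Z.of_nat t); ring.
move=> p pl; have pp := sieving_prime (sieving_bad_primes _ _) pl.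
have /negP := allP Ht p pl; rewrite disc_shift => H D; apply: H.
by apply/(affine_badP _ _ _ (prime_gt0 pp)); move: D; congr (_ | _); ring.
Qed.

Lemma survivors_le_values (S : seq nat) (L : seq Z) : uniq S ->
  {in S, forall t, 2 * (n0 + h * Z.of_nat t) \in L} -> (size S <= size L)%N.
Proof.
move=> US H; rewrite -(size_map (fun t => 2 * (n0 + h * Z.of_nat t))); apply: uniq_leq_size.
  by rewrite map_inj_uniq // => t u E; have [_ _ _ _ h0] := core_pos; nia.
by move=> _ /mapP[t /H Ht ->].
Qed.

(** By [sieved_M], every n < h X satisfies 2 n <= M. *)
Lemma few_values X (L : seq Z) : (X <= kappa)%N ->
  (forall n x1 x2 x3, n < h * Z.of_nat X -> 2 * n <= M ->
     form2 M a1 s1 a2 s2 a3 s3 x1 x2 x3 = 2 * n -> 2 * n \in L) ->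
  surv R X <= Z.of_nat (size L).
Proof.
move=> Xk H; have := survivors_wheel (X := X) (sieving_bad_primes _ _) bad_one_class.
suff : (size (survivors bad l X) <= size L)%N by rewrite -/l -/R; lia.
apply: survivors_le_values; first by rewrite filter_uniq ?iota_uniq.
move=> t; rewrite mem_filter mem_iota => /andP[Ht /andP[_ tX]].
have [x1 [x2 [x3 Ex]]] := survivor_rep Ht.
have := sieved_n0 core; have := sieved_M core; move=> HM Hn.
have [_ _ _ _ h0] := core_pos.
apply: H Ex; nia.
Qed.

Lemma form2_parts x1 x2 x3 n : form2 M a1 s1 a2 s2 a3 s3 x1 x2 x3 = 2 * n -> 2 * n <= M ->
  [/\ a1 * poly2 M s1 x1 \in [:: 0; a1 * (M - Z.abs s1)],
      a2 * poly2 M s2 x2 \in [:: 0; a2 * (M - Z.abs s2)] &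
      a3 * poly2 M s3 x3 \in [:: 0; a3 * (M - Z.abs s3)]].
Proof.
rewrite /form2 => E HM; have [A1 A2 A3 _ _] := core_pos.
have P1 := Z.mul_nonneg_nonneg _ _ (Z.lt_le_incl _ _ A1) (poly2_ge0 M s1 x1 (proj1 (sieved_s1 core))).
have P2 := Z.mul_nonneg_nonneg _ _ (Z.lt_le_incl _ _ A2) (poly2_ge0 M s2 x2 (proj1 (sieved_s2 core))).
have P3 := Z.mul_nonneg_nonneg _ _ (Z.lt_le_incl _ _ A3) (poly2_ge0 M s3 x3 (proj1 (sieved_s3 core))).
by split; apply: poly2_values => //; try lia; [exact: sieved_s1 core | exact: sieved_s2 core | exact: sieved_s3 core].
Qed.

Let v1 := a1 * (M - Z.abs s1).
Let v2 := a2 * (M - Z.abs s2).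
Let v3 := a3 * (M - Z.abs s3).

Lemma surv_le_8 : surv R kappa <= 8.
Proof.
apply: (few_values (L := [seq x + y | x <- [seq x + y | x <- [:: 0; v1], y <- [:: 0; v2]], y <- [:: 0; v3]])) => //.
move=> n x1 x2 x3 _ HM Ex; have [H1 H2 H3] := form2_parts Ex HM.
rewrite -Ex /form2; apply: allpairs_f => //; exact: allpairs_f.
Qed.

(** Otherwise x3 contributes nothing in the whole window, and x1 and x2 give at most 4 values. The
    next two lemmas drop further variables and count 2 values and 1. *)
Lemma a3_small X : (X <= kappa)%N -> 5 <= surv R X -> a3 < h * Z.of_nat X.
Proof.
move=> Xk HX; case: (Z.lt_ge_cases a3 (h * Z.of_nat X)) => // H.
suff : surv R X <= 4 by lia.
apply: (few_values (L := [seq x + y | x <- [:: 0; v1], y <- [:: 0; v2]])) => //.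
move=> n x1 x2 x3 Hn HM Ex; have [H1 H2 _] := form2_parts Ex HM.
have E3 : poly2 M s3 x3 = 0 by apply: below_a3 Ex _; lia.
by rewrite -Ex /form2 E3 Z.mul_0_r Z.add_0_r; apply: allpairs_f.
Qed.

Lemma a2_small X : (X <= kappa)%N -> 3 <= surv R X -> a2 < h * Z.of_nat X.
Proof.
move=> Xk HX; case: (Z.lt_ge_cases a2 (h * Z.of_nat X)) => // H.
suff : surv R X <= 2 by lia.
apply: (few_values (L := [:: 0; v1])) => //.
move=> n x1 x2 x3 Hn HM Ex; have [H1 _ _] := form2_parts Ex HM.
have E3 : poly2 M s3 x3 = 0 by apply: below_a3 Ex _; have := sieved_a23 core; lia.
have E2 : poly2 M s2 x2 = 0 by apply: below_a2 Ex _; lia.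
by rewrite -Ex /form2 E2 E3 !Z.mul_0_r !Z.add_0_r.
Qed.

Lemma a1_small X : (X <= kappa)%N -> 2 <= surv R X -> a1 < h * Z.of_nat X.
Proof.
move=> Xk HX; case: (Z.lt_ge_cases a1 (h * Z.of_nat X)) => // H.
suff : surv R X <= 1 by lia.
apply: (few_values (L := [:: 0])) => //.
move=> n x1 x2 x3 Hn HM Ex; have [A1 A2 A3 _ _] := core_pos.
have H12 := sieved_a12 core; have H23 := sieved_a23 core.
have E3 : poly2 M s3 x3 = 0 by apply: below_a3 Ex _; lia.
have E2 : poly2 M s2 x2 = 0 by apply: below_a2 Ex _; lia.
move: Ex; rewrite /form2 E2 E3 !Z.mul_0_r !Z.add_0_r => Ex.
have E1 : poly2 M s1 x1 = 0.
  by apply: (@poly2_small a1 s1 x1 n) => //; [exact: sieved_s1 core | lia | lia].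
by rewrite -Ex E1 Z.mul_0_r.
Qed.

Lemma core_prodZ_le : wheel_prod 0 R <= prodZ l /\ prodZ l <= a1 * a2 * a3.
Proof.
have sl : sieving l := sieving_bad_primes _ _; split.
  by have := wheel_prod_le (k := 0) sl; rewrite subn0 drop0.
apply: Z.divide_pos_le; first by case: core_pos.
apply: prodZ_divide; first exact: sieving_uniq.
  by apply/allP => p; exact: sieving_prime.
by move=> p /core_bad[].
Qed.

Lemma mul_lt3 x y z u v w : 0 < x < u -> 0 < y < v -> 0 < z < w -> x * y * z < u * v * w.
Proof.
move=> H1 H2 H3; have : x * y < u * v by nia.
have : 0 < x * y by nia.
nia.
Qed.

(** Let p1 be the least bad prime. Then a1 <= a2 < h p1 J, and a3 < h p J with p <= a2, so a1 a2 a3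
    < h^4 J^4 p1^3. Here p1^3 is at most the product of the three least bad primes, and h^4 J^4 at
    most that of the others. *)
Lemma gap_contradiction p J : p \in l -> (Z.of_nat p | a1 * a2) -> (6 < R)%N ->
  sieve_gap R.-1 J -> h ^ 4 * Z.of_nat J ^ 4 <= wheel_prod 3 (R - 3) -> False.
Proof.
move=> pl p12 R6 HJ Hw; have sl : sieving l := sieving_bad_primes _ _.
have [_ HD] := core_prodZ_le; have [A1 A2 A3 _ h0] := core_pos.
have H12 := sieved_a12 core; have H23 := sieved_a23 core.
have [p1 [p2 [p3 [r El]]]] : exists p1 p2 p3 r, l = [:: p1, p2, p3 & r].
  by move: R6; rewrite /R; case: (l) => [|p1 [|p2 [|p3 r]]] //; exists p1, p2, p3, r.
have Hr : wheel_prod 3 (R - 3) <= prodZ r.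
  by have := wheel_prod_le (k := 3) sl; rewrite -/R El /= drop0.
have p1l : p1 \in l by rewrite El mem_head.
have [lt12 lt13] : (p1 < p2 /\ p1 < p3)%N.
  by case/andP: sl => /=; rewrite El /= => /and3P[H1 H2 _] _; split=> //; exact: ltn_trans H2.
have H2 := unary_gap p1l HJ.
have H3 := binary_gap pl p12 HJ.
have pa2 : Z.of_nat p <= a2.
  have [pp _ _ _] := core_bad pl.
  by case/(prime_mult _ pp): p12 => /Z.divide_pos_le; lia.
have [_ p15 _ _] := core_bad p1l.
set j := Z.of_nat J in H2 H3 Hw *; set x := h * Z.of_nat p1 * j in H2 *.
have j0 : 0 < j by rewrite /x in H2; nia.
have x0 : 0 < x by lia.
have hj : 0 < h * j by nia.
have H3' : a3 < x * (h * j) by nia.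
have := mul_lt3 (conj A1 (Z.le_lt_trans _ _ _ H12 H2)) (conj A2 H2) (conj A3 H3').
have -> : x * x * (x * (h * j)) = (h ^ 4 * j ^ 4) * (Z.of_nat p1 * Z.of_nat p1 * Z.of_nat p1).
  by rewrite /x; ring.
have : prodZ l = Z.of_nat p1 * Z.of_nat p2 * Z.of_nat p3 * prodZ r by rewrite El /=; ring.
set q1 := Z.of_nat p1 in p15 *; have q12 : q1 <= Z.of_nat p2 by lia.
have q13 : q1 <= Z.of_nat p3 by lia.
have q11 : 0 <= q1 * q1 by apply: Z.mul_nonneg_nonneg; lia.
have q112 : q1 * q1 <= q1 * Z.of_nat p2 by apply: Z.mul_le_mono_nonneg_l; lia.
have q123 : q1 * q1 * q1 <= q1 * Z.of_nat p2 * Z.of_nat p3 by apply: Z.mul_le_mono_nonneg; lia.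
have q0 : 0 < q1 * q1 * q1 by apply: Z.mul_pos_pos; [apply: Z.mul_pos_pos|]; lia.
move: (q1 * Z.of_nat p2 * Z.of_nat p3) q123 => b q123 EP.
move: (q1 * q1 * q1) q123 q0 => a q123 q0 ltA.
have w0 : 0 < h ^ 4 * j ^ 4 by apply: Z.mul_pos_pos; apply: Z.pow_pos_nonneg.
have : h ^ 4 * j ^ 4 * a <= prodZ r * b by apply: Z.mul_le_mono_nonneg; lia.
lia.
Qed.

Lemma coprime_a12 : (6 < R)%N /\ {in l, forall p, ~ (Z.of_nat p | a1 * a2)}.
Proof.
have [Hw HD] := core_prodZ_le; have [A1 A2 A3 _ h0] := core_pos.
have H12 := sieved_a12 core.
case: (leqP 22 R) => HR.
  split; first lia.
  move=> p pl p12; apply: (gap_contradiction pl p12 _ (or_intror (erefl (2 ^ R.-1)%N))); first lia.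
  have -> : Z.of_nat (2 ^ R.-1)%N = 2 ^ Z.of_nat R.-1.
    elim: (R.-1) => [|n IH] //; rewrite expnS Nat2Z.inj_succ Z.pow_succ_r; lia.
  exact: power_lt_wheel_prod core_h12 HR.
case: (sieve_certificateP (sieved_h core) HR).
- by have := surv_le_8; lia.
- move=> X2 X3 X5 k2 k3 k5 S2 S3 S5 HX.
  have B1 := a1_small k2 S2; have B2 := a2_small k3 S3; have B3 := a3_small k5 S5.
  have := mul_lt3 (conj A1 B1) (conj A2 B2) (conj A3 B3).
  have -> : h * Z.of_nat X2 * (h * Z.of_nat X3) * (h * Z.of_nat X5) =
    h ^ 3 * Z.of_nat X2 * Z.of_nat X3 * Z.of_nat X5 by ring.
  lia.
- move=> X2 X3 J R6 k2 k3 S2 S3 HJ HX; split=> // p pl p12.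
  have B1 := a1_small k2 S2; have B2 := a2_small k3 S3.
  have B3 := binary_gap pl p12 (or_introl HJ).
  have pa2 : Z.of_nat p <= a2.
    have [pp _ _ _] := core_bad pl.
    by case/(prime_mult _ pp): p12 => /Z.divide_pos_le; lia.
  set j := Z.of_nat J in B3 HX *.
  have [_ p5 _ _] := core_bad pl.
  have hp : 0 < h * Z.of_nat p by nia.
  have j0 : 0 < j by nia.
  have hj : 0 < h * j by nia.
  have B3' : a3 < (h * Z.of_nat X3) * (h * j) by nia.
  have := mul_lt3 (conj A1 B1) (conj A2 B2) (conj A3 B3').
  have -> : h * Z.of_nat X2 * (h * Z.of_nat X3) * (h * Z.of_nat X3 * (h * j)) =
    h ^ 4 * Z.of_nat X2 * Z.of_nat X3 ^ 2 * j by ring.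
  lia.
- move=> J R6 HJ HX; split=> // p pl p12.
  exact: (gap_contradiction pl p12 R6 (or_introl HJ) HX).
Qed.

Lemma prodZ_le_a3 : prodZ l <= a3.
Proof.
have sl : sieving l := sieving_bad_primes _ _; have [_ Hc] := coprime_a12.
apply: Z.divide_pos_le; first by case: core_pos.
apply: prodZ_divide; first exact: sieving_uniq.
  by apply/allP => p; exact: sieving_prime.
by move=> p pl; have [pp _ _ pA] := core_bad pl; case/(prime_mult _ pp): pA => // /(Hc p pl).
Qed.

(** A full period of all the bad primes, stretched by h, might exceed a3. Leaving out the largest
    prime q, which is at least h, gives h D <= q D <= a3. Over the period D, q removes at most the
    ceiling of D / q survivors, and the others inject into the pairs (x1, x2). *)
Lemma counting : exists l' q B1 B2, let D := prodZ l' in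
  [/\ l = rcons l' q /\ sieving l', 0 <= B1 /\ 0 <= B2,
     a1 * M * (B1 * B1) <= 2 * h * D /\ a2 * M * (B2 * B2) <= 2 * h * D &
     Z.of_nat q * (predprodZ l' - (2 * B1 + 3) * (2 * B2 + 3)) <= D + Z.of_nat q - 1].
Proof.
have sl : sieving l := sieving_bad_primes _ _; have [R6 _] := coprime_a12.
have [l' [q El]] : exists l' q, l = rcons l' q.
  by move: R6; rewrite /R; case/lastP: (l) => // l' q _; exists l', q.
have [sl' lt_q] : sieving l' /\ {in l', forall p, (p < q)%N}.
  move: sl; rewrite El /sieving all_rcons => /andP[s /andP[_ ->]].
  move: s; rewrite (sorted_pairwise ltn_trans) pairwise_rcons => /andP[/allP H s].
  by split=> //; rewrite (sorted_pairwise ltn_trans) s.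
have [A1 A2 A3 _ h0] := core_pos; have M0 := core_M0.
have ql : q \in l by rewrite El mem_rcons mem_head.
have hq : h <= Z.of_nat q.
  have [_ h12] := core_h12; have Rl : (R.-1 < size l)%N by rewrite /R in R6 *; lia.
  have := wheel_le_nth sl Rl; rewrite {1}El /R nth_rcons El size_rcons ltnn eqxx /wheel.
  by move: R6; rewrite /R El size_rcons; lia.
set D := prodZ l'.
have D0 : 0 < D by apply: prodZ_pos; apply/allP => p; exact: sieving_pos.
pose B a := Z.sqrt (2 * h * D / (a * M)).
have HB a : 0 < a -> a * M * (B a * B a) <= 2 * h * D.
  move=> a0; have aM : 0 < a * M by nia.
  have hD : 0 <= 2 * h * D by apply: Z.mul_nonneg_nonneg; lia.
  have [Hs _] := Z.sqrt_spec _ (Z.div_pos _ _ hD aM).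
  apply: (Z.le_trans _ (a * M * (2 * h * D / (a * M)))); last exact: Z.mul_div_le.
  by apply: Z.mul_le_mono_nonneg_l; [lia | exact: Hs].
have B0 a : 0 <= B a by exact: Z.sqrt_nonneg.
exists l', q, (B a1), (B a2); split=> //; try by split; try apply: HB.
set P := (\prod_(p <- l') p)%N.
have EP : D = Z.of_nat P by rewrite /D prodZ_prod.
have one' : {in l', forall p, one_class bad p}.
  by move=> p pl; apply: bad_one_class; rewrite El mem_rcons inE pl orbT.
have Hper : (\prod_(p <- l') p.-1 <= size (survivors bad l' P))%N.
  apply: survivors_period => //; first exact: sieving_uniq.
    by apply/allP => p; exact: sieving_prime.
  by move=> p pl t u; apply: affine_periodic; exact: sieving_pos pl.
pose S := [seq t <- survivors bad l' P | ~~ bad q t].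
have q0 : (0 < q)%N by exact: sieving_pos ql.
have Hq : (size (survivors bad l' P) <= size S + (P + q.-1) %/ q)%N.
  apply: leq_trans (leq_add (leqnn _) (count_class P q0 (bad_one_class ql))).
  rewrite /S size_filter -(count_predC (bad q) (survivors bad l' P)) addnC leq_add2l.
  by rewrite /survivors count_filter; apply: sub_count => t /andP[].
pose L := [seq a1 * poly2 M s1 x + a2 * poly2 M s2 y |
  x <- centered_range (B a1), y <- centered_range (B a2)].
have HS : (size S <= size L)%N.
  apply: survivors_le_values; first by rewrite !filter_uniq ?iota_uniq.
  move=> t; rewrite !mem_filter mem_iota => /andP[Hqt /andP[Ht /andP[_ tP]]].
  have Hall : all (fun p => ~~ bad p t) l by rewrite El all_rcons Hqt.
  have [x1 [x2 [x3 Ex]]] := survivor_rep Hall.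
  have nP : n0 + h * Z.of_nat t < h * D by rewrite EP; have := sieved_n0 core; nia.
  have qD : h * D <= a3.
    apply: Z.le_trans prodZ_le_a3.
    by rewrite El -cats1 prodZ_cat /=; rewrite -/D; nia.
  have E3 := below_a3 Ex (Z.lt_le_trans _ _ _ nP qD).
  have P1 := Z.mul_nonneg_nonneg _ _ (Z.lt_le_incl _ _ A1) (poly2_ge0 M s1 x1 (proj1 (sieved_s1 core))).
  have P2 := Z.mul_nonneg_nonneg _ _ (Z.lt_le_incl _ _ A2) (poly2_ge0 M s2 x2 (proj1 (sieved_s2 core))).
  move: Ex; rewrite /form2 E3 Z.mul_0_r Z.add_0_r => Ex; rewrite -Ex.
  apply: allpairs_f; apply: mem_centered_range => //.
    by apply: (poly2_root_bound (s := s1)) => //; [exact: sieved_s1 core | lia].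
  by apply: (poly2_root_bound (s := s2)) => //; [exact: sieved_s2 core | lia].
move: HS; rewrite /L size_allpairs !size_map !size_iota => HS.
have HSZ : Z.of_nat (size S) <= (2 * B a1 + 3) * (2 * B a2 + 3).
  have := B0 a1; have := B0 a2; move: (B a1) (B a2) HS => b1 b2 HS b20 b10.
  have E1 : Z.of_nat (Z.to_nat (2 * b1 + 3)) = 2 * b1 + 3 by lia.
  have E2 : Z.of_nat (Z.to_nat (2 * b2 + 3)) = 2 * b2 + 3 by lia.
  by rewrite -E1 -E2 -Nat2Z.inj_mul; lia.
have Hc : Z.of_nat q * Z.of_nat ((P + q.-1) %/ q) <= D + Z.of_nat q - 1.
  by have := leq_divM (P + q.-1) q; rewrite EP; nia.
have : predprodZ l' <= Z.of_nat (size S) + Z.of_nat ((P + q.-1) %/ q).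
  by rewrite predprodZ_prod; lia.
move: (Z.of_nat (size S)) (Z.of_nat (_ %/ _)) HSZ Hc => x y HSZ Hc Hp.
have : predprodZ l' - (2 * B a1 + 3) * (2 * B a2 + 3) <= y by lia.
move: (_ - _) => z zy; nia.
Qed.

Lemma core_size : (51 <= R)%N /\
  a1 * a2 * (M * M) <= 64 * (h * h) * ((Z.of_nat R + 3) * (Z.of_nat R + 3)).
Proof.
have sl : sieving l := sieving_bad_primes _ _; have [R6 _] := coprime_a12.
have [A1 A2 A3 _ h0] := core_pos; have M0 := core_M0; have M38 := core_M.
have [l' [q [B1 [B2 [[El sl'] [B10 B20] [HB1 HB2] Hq]]]]] := counting.
have Sl' : size l' = R.-1 by rewrite /R El size_rcons.
have Rl : (R.-1 < size l)%N by rewrite /R in R6 *; lia.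
have Wq : (wheel R.-1 <= q)%N.
  by have := wheel_le_nth sl Rl; rewrite El nth_rcons Sl' ltnn eqxx.
(* The constant 19 comes from M >= 38 h. *)
have B19 a B : 0 < a -> a * M * (B * B) <= 2 * h * prodZ l' -> 19 * (B * B) <= prodZ l'.
  move=> a0 H; apply: (Zmult_le_reg_r _ _ (2 * h)); first lia.
  have : 38 * h * (B * B) <= a * M * (B * B).
    by apply: Z.mul_le_mono_nonneg_r; [exact: Z.square_nonneg | nia].
  lia.
have D0 : 0 < prodZ l' by apply: prodZ_pos; apply/allP => p; exact: sieving_pos.
have HW : wheel_prod 0 R.-1 <= prodZ l'.
  by have := wheel_prod_le (k := 0) sl'; rewrite subn0 drop0 Sl'.
have HQ : 100 * (Z.of_nat R.-1 + 4) ^ 2 <= prodZ l'.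
  by apply: Z.le_trans HW; apply: wheel_prod_quadratic; lia.
case: (leqP 51 R) => HR; last first.
  have Hr := wheel_ratio sl'; rewrite Sl' in Hr.
  have HE : 0 < wheel_prod 0 R.-1.
    by have := @wheel_prod_quadratic R.-1 ltac:(lia); nia.
  (* This contradicts [HQ], which gives at least 10000 because R > 6. *)
  have : prodZ l' <= 5000.
    apply: (counting_bound_small _ HE D0 (wheel_ratio_lower R6 HR) Hr Hq B10 B20 (B19 _ _ A1 HB1) (B19 _ _ A2 HB2)).
    by have : (0 < wheel R.-1)%N; [rewrite /wheel; lia | lia].
  nia.
split=> //; set r := Z.of_nat R + 3.
case: (Z.le_gt_cases (a1 * a2 * (M * M)) (64 * (h * h) * (r * r))) => // Hbig.
have Er : Z.of_nat R.-1 + 4 = r by rewrite /r; lia.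
rewrite Er in HQ.
have HPhi := predprodZ_lower sl'.
rewrite Sl' in HPhi; have Er' : Z.of_nat (R.-1 + 4) = r by rewrite /r; lia.
rewrite Er' in HPhi.
set D := prodZ l' in D0 HW HQ HPhi HB1 HB2 Hq B19.
(* The product of [HB1] and [HB2] is a1 a2 M^2 (B1 B2)^2 <= 4 h^2 D^2; the constant 64 = 4 * 4^2
   yields the factor 4 r. *)
have HBB : 4 * r * (B1 * B2) <= D.
  have r0 : 0 < r by rewrite /r; lia.
  have b0 : 0 <= B1 * B2 by apply: Z.mul_nonneg_nonneg.
  have H1 : (a1 * M * (B1 * B1)) * (a2 * M * (B2 * B2)) <= (2 * h * D) * (2 * h * D).
    by apply: Z.mul_le_mono_nonneg => //; apply: Z.mul_nonneg_nonneg; nia.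
  have H2 : 64 * (h * h) * (r * r) * ((B1 * B2) * (B1 * B2)) <=
            a1 * a2 * (M * M) * ((B1 * B2) * (B1 * B2)).
    by apply: Z.mul_le_mono_nonneg_r; [exact: Z.square_nonneg | lia].
  apply/Z.square_le_simpl_nonneg; first lia.
  apply: (Zmult_le_reg_r _ _ (4 * (h * h))); first nia.
  lia.
have rq : r <= Z.of_nat q by rewrite /r; move: Wq; rewrite /wheel; lia.
have r6 : 6 <= r by rewrite /r; lia.
have HQ' : 100 * (r * r) <= D by move: HQ; rewrite Z.pow_2_r.
have := counting_bound_large r6 rq HQ' HPhi Hq B10 B20 (B19 _ _ A1 HB1) (B19 _ _ A2 HB2) HBB.
lia.
Qed.

(** The factor 3 M in w makes q prime to 3 M. A bad prime excludes at most two opposite classes of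
    t, so 2 R classes in all and a window of length 2^(2R) = 4^R. *)
Lemma core_inert : exists q t, [/\ Znumtheory.prime q, forall s, ~ (q | s * s + a1 * a2),
  0 < t <= 4 ^ Z.of_nat R, (q | 4 * (a1 * a2) * (3 * M * t) * (3 * M * t) - 1) &
  {in l, forall p, ~ (Z.of_nat p | 4 * (a1 * a2) * (3 * M * t) * (3 * M * t) - 1)}].
Proof.
have sl : sieving l := sieving_bad_primes _ _.
have [A1 A2 A3 _ h0] := core_pos; have M0 := core_M0.
pose T t := 4 * (a1 * a2) * (3 * M * t) * (3 * M * t) - 1.
pose badT (p t : nat) : bool := T (Z.of_nat t + 1) mod Z.of_nat p =? 0.
have badTP p t : (0 < p)%N -> reflect (Z.of_nat p | T (Z.of_nat t + 1)) (badT p t).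
  move=> p0; apply: (iffP idP) => [/Z.eqb_eq|] H; first by apply/Z.mod_divide; [lia|].
  by apply/Z.eqb_eq/Z.mod_divide; [lia|].
have Hcov p : p \in l -> exists2 cs, covers cs badT p & (size cs <= 2)%N.
  move=> pl; have p0 := sieving_pos sl pl; have pp := prime_Zprime (sieving_prime sl pl).
  have p2 := prime_ge_2 _ pp.
  case E : (has (badT p) (iota 0 p)); last first.
    exists [::] => //; split=> //= t; apply/negbTE/negP => /(badTP _ _ p0)[k Hk].
    move/negbT/hasPn: E => /(_ (t %% p)%N); rewrite mem_iota /= add0n ltn_pmod // => /(_ isT) /negP; apply.
    apply/(badTP _ _ p0).
    have Et : Z.of_nat t = Z.of_nat (t %/ p)%N * Z.of_nat p + Z.of_nat (t %% p)%N.
      by rewrite {1}(divn_eq t p); lia.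
    move: (Z.of_nat (t %/ p)%N) (Z.of_nat (t %% p)%N) Et => x y Et.
    exists (k - 4 * (a1 * a2) * (9 * M * M) * x * (2 * (y + 1) + x * Z.of_nat p)).
    by rewrite [RHS]Z.mul_sub_distr_r -Hk Et /T; ring.
  have /hasP[r] := E; rewrite mem_iota add0n => /andP[_ rp] /(badTP _ _ p0)[k Hk].
  (* The variable is t + 1, to keep it positive, so the root opposite to r is - r - 2. *)
  exists [:: (p, r); (p, 2 * p - 2 - r)%N] => //; split=> /=; first by rewrite p0.
  move=> t; rewrite orbF; apply/(badTP _ _ p0)/orP; last first.
    case=> /(eqmod_Zdivide _ _ p0)[j Hj].
      exists (k + 4 * (a1 * a2) * (9 * M * M) * j * (2 * (Z.of_nat r + 1) + j * Z.of_nat p)).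
      have -> : Z.of_nat t = Z.of_nat r + j * Z.of_nat p by lia.
      by rewrite [RHS]Z.mul_add_distr_r -Hk /T; ring.
    exists (k + 4 * (a1 * a2) * (9 * M * M) * (j + 2) * (- 2 * (Z.of_nat r + 1) + (j + 2) * Z.of_nat p)).
    have -> : Z.of_nat t = - Z.of_nat r - 2 + (j + 2) * Z.of_nat p by lia.
    by rewrite [RHS]Z.mul_add_distr_r -Hk /T; ring.
  case=> d Hd.
  set c := 4 * (a1 * a2) * (9 * M * M).
  have : (Z.of_nat p | c * ((Z.of_nat t - Z.of_nat r) * (Z.of_nat t + Z.of_nat r + 2))).
    by exists (d - k); rewrite [RHS]Z.mul_sub_distr_r -Hk -Hd /T /c; ring.
  case/(prime_mult _ pp) => [[j Hj]|/(prime_mult _ pp)[[j Hj]|[j Hj]]].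
  - have : (Z.of_nat p | 1).
      exists (j * ((Z.of_nat r + 1) * (Z.of_nat r + 1)) - k).
      have -> : (j * ((Z.of_nat r + 1) * (Z.of_nat r + 1)) - k) * Z.of_nat p =
        (j * Z.of_nat p) * ((Z.of_nat r + 1) * (Z.of_nat r + 1)) - k * Z.of_nat p by ring.
      by rewrite -Hj -Hk /T /c; ring.
    by move/Z.divide_pos_le; lia.
  - by left; apply/(eqmod_Zdivide _ _ p0); exists j; lia.
  by right; apply/(eqmod_Zdivide _ _ p0); exists (j - 2); lia.
(* Taking t + 1 to be the product of the bad primes makes T equal to - 1 modulo each of them, so a
   survivor exists. *)
have [|t tlt /allP Ht] := @sieve_exponential badT 2 l (\prod_(p <- l) p).-1 Hcov.
  apply/allP => p pl; have p0 := sieving_pos sl pl; apply/negP => /(badTP _ _ p0)[k Hk].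
  have P0 : (0 < \prod_(p <- l) p)%N.
    by rewrite big_seq prodn_cond_gt0 // => r; exact: sieving_pos.
  have [j Hj] : exists j, Z.of_nat (\prod_(p <- l) p) = j * Z.of_nat p.
    by exists (Z.of_nat (\prod_(x <- rem p l) x)); rewrite (big_rem p pl) /=; lia.
  have Et : Z.of_nat (\prod_(p <- l) p).-1 + 1 = j * Z.of_nat p by rewrite -Hj; lia.
  have : (Z.of_nat p | 1).
    exists (4 * (a1 * a2) * (9 * M * M) * j * j * Z.of_nat p - k).
    by rewrite [RHS]Z.mul_sub_distr_r -Hk Et /T; ring.
  by have := prime_ge_2 _ (prime_Zprime (sieving_prime sl pl)) => p2 /Z.divide_pos_le; lia.
have w0 : 0 < 3 * M * (Z.of_nat t + 1) by nia.
have d0 : 0 < a1 * a2 by nia.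
have [q [qp [qT Hq]]] := inert_prime _ _ d0 w0.
exists q, (Z.of_nat t + 1); split=> //.
  have : Z.of_nat (2 ^ (2 * R)) = 4 ^ Z.of_nat R.
    elim: (R) => [|n IH] //; rewrite mulnS expnD Nat2Z.inj_succ Z.pow_succ_r; lia.
  by move: tlt; rewrite -/R; lia.
move=> p pl; have p0 := sieving_pos sl pl; have /negP H := Ht p pl.
by move=> D; apply: H; apply/(badTP _ _ p0).
Qed.

Lemma core_false : False.
Proof.
have sl : sieving l := sieving_bad_primes _ _.
have [A1 A2 A3 A0 h0] := core_pos; have M0 := core_M0; have [h1 h12] := core_h12.
have [R51 Hsize] := core_size; have [HW _] := core_prodZ_le; have HD3 := prodZ_le_a3.
have [q [t [qp Hinert Ht qT Hl]]] := core_inert.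
have q2 := prime_ge_2 _ qp.
have qn1 : ~ (q | 1) by move/Z.divide_pos_le; lia.
have q3M : ~ (q | 3 * M).
  move=> [j Hj]; apply: qn1; have [k Hk] := qT.
  by exists (4 * (a1 * a2) * (j * t) * (3 * M * t) - k); rewrite [RHS]Z.mul_sub_distr_r -Hk Hj; ring.
have q12 : ~ (q | a1 * a2).
  move=> [j Hj]; apply: qn1; have [k Hk] := qT.
  by exists (4 * j * (3 * M * t) * (3 * M * t) - k); rewrite [RHS]Z.mul_sub_distr_r -Hk Hj; ring.
have qM : ~ (q | M) by move=> [j Hj]; apply: q3M; exists (3 * j); lia.
have q5 : 5 <= q.
  have q_2 : q <> 2.
    move=> Eq; apply: qn1; have [k Hk] := qT; rewrite Eq in Hk *.
    by exists (2 * (a1 * a2) * (3 * M * t) * (3 * M * t) - k); rewrite [RHS]Z.mul_sub_distr_r -Hk; ring.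
  have q_3 : q <> 3 by move=> Eq; apply: q3M; rewrite Eq; exists M; ring.
  have q_4 : q <> 4.
    by move=> Eq; have /(prime_divisors _ qp) : (2 | q); [exists 2; lia | lia].
  lia.
pose p := Z.to_nat q; have Ep : q = Z.of_nat p by rewrite /p; lia.
have qA : ~ (q | a1 * a2 * a3).
  move=> qA; have pl : p \in l by apply/bad_primesP => //; rewrite -Ep.
  by apply: (Hl p pl); rewrite -Ep.
have [qh q8] := core_h_coprime qp q5.
have q8M : ~ (q | 8 * M) by exact: prime_not_divide_mul.
have [u [k Hu]] := prime_inverse _ _ qp q8M.
pose G n := 8 * M * n + a1 * (s1 * s1) + a2 * (s2 * s2).
(* The class modulo q in which q divides the binary completed square G. *)
pose c := - u * (a1 * (s1 * s1) + a2 * (s2 * s2)).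
have [c0 Hc0 [hc0 [j Hj]]] := chinese_class c qh qp.
have [g Hg] : exists g, G c0 = q * g.
  exists (8 * M * j - k * (a1 * (s1 * s1) + a2 * (s2 * s2))).
  rewrite /G; have -> : c0 = c + j * q by lia.
  rewrite /c; have -> : 8 * M * (- u * (a1 * (s1 * s1) + a2 * (s2 * s2)) + j * q) =
    - (u * (8 * M)) * (a1 * (s1 * s1) + a2 * (s2 * s2)) + 8 * M * j * q by ring.
  have -> : u * (8 * M) = k * q + 1 by lia.
  ring.
(* For n = c0 + h q tau, the sieve at q keeps G n / q prime to q, and at the bad primes it keeps the
   ternary completed square a unit. One class per prime for R + 1 primes gives tau < 2^(R+1). *)
pose bad' r := if r == p then affine_bad (8 * M * h) g r
  else affine_bad (8 * M * h * q) (disc c0) r.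
have p_notin : p \notin l.
  apply/negP => pl; apply: qA; rewrite Ep; by have [] := core_bad pl.
have prime_p : prime p by apply: Zprime_prime; rewrite -Ep.
have [||||tau tlt Htau] := @sieve_single bad' (p :: l).
- by rewrite /= p_notin sieving_uniq.
- by rewrite /= prime_p; apply/allP => r; exact: sieving_prime.
- move=> r rl x y; rewrite /bad'; have r0 : (0 < r)%N.
    by move: rl; rewrite inE => /orP[/eqP->|/(sieving_pos sl)//]; exact: prime_gt0.
  by case: (r == p); apply: affine_periodic.
- move=> r; rewrite inE => /orP[/eqP->|rl].
    rewrite /one_class /bad' eqxx; apply: affine_one_class => //; rewrite -Ep.
    by apply: prime_not_divide_mul.
  have rp : (r == p) = false by apply/negbTE; apply: contraNneq p_notin => <-.
  rewrite /one_class /bad' rp; apply: affine_one_class; first exact: sieving_prime rl.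
  apply: prime_not_divide_mul; first by have [] := core_bad rl.
    exact: core_step_ndiv.
  rewrite Ep => /dvdn_Zdivide; rewrite dvdn_prime2 ?rp //; exact: sieving_prime rl.
pose n := c0 + h * q * Z.of_nat tau.
have n_lo : 0 <= n.
  by apply: Z.add_nonneg_nonneg; [lia | apply: Z.mul_nonneg_nonneg; [apply: Z.mul_nonneg_nonneg|]; lia].
(* With q <= 36 a1 a2 M^2 t^2, t <= 4^R and [core_size], n < h q 2^(R+1) is below the product of the
   bad primes, which is at most a3. *)
have n_a3 : n < a3.
  set r := Z.of_nat R in Hsize Ht; set Y := 2 ^ r.
  have Y0 : 0 < Y by apply: Z.pow_pos_nonneg; rewrite /r; lia.
  have EX : 4 ^ r = Y * Y by rewrite /Y -Z.pow_mul_l.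
  have tauY : Z.of_nat tau < 2 * Y.
    have <- : Z.of_nat (2 ^ R.+1) = 2 * Y.
      rewrite /Y /r; elim: (R) => [|i IH] //.
      by rewrite expnS Nat2Z.inj_succ Z.pow_succ_r; lia.
    by move: tlt; rewrite /= -/R; lia.
  have Hw := wheel_prod_exponential R51; rewrite -/r in Hw.
  have E32 : 32 ^ r = Y * Y * Y * Y * Y by rewrite /Y -!Z.pow_mul_l.
  rewrite E32 Z.pow_2_r in Hw.
  set S := (r + 3) * (r + 3) in Hsize Hw.
  have tt : t * t <= Y * Y * (Y * Y) by rewrite -EX; apply: Z.mul_le_mono_nonneg; lia.
  have qle : q <= 36 * (a1 * a2 * (M * M)) * (t * t) - 1.
    have d0 : 0 < a1 * a2 by nia.
    have dM : 0 < a1 * a2 * (M * M) by apply: Z.mul_pos_pos => //; nia.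
    have dMt : 0 < a1 * a2 * (M * M) * (t * t) by apply: Z.mul_pos_pos => //; nia.
    have := Z.divide_pos_le _ _ _ qT; lia.
  have HH : 36 * (a1 * a2 * (M * M)) * (t * t) <= 36 * (64 * (h * h) * S) * (Y * Y * (Y * Y)).
    apply: Z.mul_le_mono_nonneg; try lia; nia.
  have nq : n < h * q * (2 * Y).
    rewrite /n; have hq0 : 0 < h * q by nia.
    have : h * q * (Z.of_nat tau + 1) <= h * q * (2 * Y) by apply: Z.mul_le_mono_nonneg_l; lia.
    lia.
  have S0 : 0 <= S * (Y * Y * Y * Y * Y).
    by apply: Z.mul_nonneg_nonneg; [exact: Z.square_nonneg | do 4 (apply: Z.mul_nonneg_nonneg; last lia); lia].
  have : h * q * (2 * Y) <= h * (36 * (64 * (h * h) * S) * (Y * Y * (Y * Y))) * (2 * Y).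
    apply: Z.mul_le_mono_nonneg_r; first lia.
    apply: Z.mul_le_mono_nonneg_l; lia.
  have -> : h * (36 * (64 * (h * h) * S) * (Y * Y * (Y * Y))) * (2 * Y) =
    4608 * (h * h * h) * (S * (Y * Y * Y * Y * Y)) by ring.
  have hhh : h * h * h <= 1728.
    have : h * h <= 144 by nia.
    nia.
  have : 4608 * (h * h * h) * (S * (Y * Y * Y * Y * Y)) <= 8000000 * (S * (Y * Y * Y * Y * Y)).
    by apply: Z.mul_le_mono_nonneg_r; lia.
  lia.
have [|r rl|x1 [x2 [x3 Ex]]] := @core_rep n n_lo.
- by have [i Hi] := hc0; exists (i + q * Z.of_nat tau); rewrite /n; lia.
- have r0 := sieving_pos sl rl.
  have rp : (r == p) = false by apply/negbTE; apply: contraNneq p_notin => <-.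
  have /negP := allP Htau r ltac:(by rewrite inE rl orbT); rewrite /bad' rp => H D; apply: H.
  by apply/(affine_badP _ _ _ r0); move: D; congr (_ | _); rewrite /n disc_shift; ring.
have E3 := below_a3 Ex n_a3.
move: Ex; rewrite /form2 E3 Z.mul_0_r Z.add_0_r => Ex.
have EG : G n = a1 * ((2 * M * x1 + s1) * (2 * M * x1 + s1)) + a2 * ((2 * M * x2 + s2) * (2 * M * x2 + s2)).
  have E8 : 8 * M * n = 4 * M * (2 * n) by ring.
  by rewrite -!complete_square /G E8 -Ex; ring.
have EGq : G n = q * (8 * M * h * Z.of_nat tau + g).
  by rewrite Z.mul_add_distr_l -Hg /G /n; ring.
have q1 : ~ (q | a1) by move=> H; apply: q12; apply: Z.divide_mul_l.
have q2' : ~ (q | a2) by move=> H; apply: q12; apply: Z.divide_mul_r.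
have qG : (q | G n) by exists (8 * M * h * Z.of_nat tau + g); rewrite EGq; ring.
rewrite EG in qG.
(* Both squares are divisible by q^2, hence so is G n, against the sieve at q. *)
have [[y1 Hy1] [y2 Hy2]] := inert_divides a1 a2 q _ _ qp q1 q2' Hinert qG.
have /negP := allP Htau p (mem_head _ _); rewrite /bad' eqxx; apply.
apply/(affine_badP _ _ _ (prime_gt0 prime_p)); rewrite -Ep.
exists (a1 * (y1 * y1) + a2 * (y2 * y2)); apply: (Z.mul_reg_l _ _ q); first lia.
by rewrite -EGq EG Hy1 Hy2; ring.
Qed.
End Core.

(** * The bounds for m *)

Unset Implicit Arguments.

Lemma regular_bound m kappa : 3 <= m -> exists_regular_ternary m ->
  step_window (step (m - 2)) kappa -> m < 2 * step (m - 2) * Z.of_nat kappa.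
Proof.
move=> m3 Hreg Hstep; case: (Z.lt_ge_cases m (2 * step (m - 2) * Z.of_nat kappa)) => // Hm.
have [a1 [s1 [a2 [s2 [a3 [s3 [[a10 a12] [a23 [A1 [A2 [A3 [H P]]]]]]]]]]]] := reduced_form m m3 Hreg.
have M0 : 0 < m - 2 by lia.
have [n0 [Hn0 Hrep]] := constraint_class _ _ _ _ _ _ _ M0 A1 A2 A3 P H.
case: (@core_false (m - 2) kappa (step (m - 2)) n0 a1 s1 a2 s2 a3 s3).
split=> //; first lia.
move=> p pp p5 pM; apply: P; split=> //; left; split=> //; lia.
Qed.

Theorem theorem1p1 (m : Z) (Hm : 3 <= m) (Hreg : exists_regular_ternary m) :
  (m mod 2 = 1 -> m mod 3 = 2 -> m <= 35) /\
  (m mod 2 = 1 -> m mod 3 <> 2 -> m <= 147) /\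
  (m mod 4 = 2 -> m mod 3 = 2 -> m <= 38) /\
  (m mod 4 = 2 -> m mod 3 <> 2 -> m <= 142) /\
  (m mod 4 = 0 -> m mod 3 = 2 -> m <= 188) /\
  (m mod 4 = 0 -> m mod 3 <> 2 -> m <= 712).
Proof.
have step_eq : step (m - 2) =
    (if m mod 3 =? 2 then 1 else 3) * (if m mod 4 =? 0 then 4 else 1).
  rewrite /step; congr (_ * _).
    by case: Z.eqb_spec; case: Z.eqb_spec => //; zdiv_lia.
  by case: Z.eqb_spec; case: Z.eqb_spec => //; zdiv_lia.
have bound kappa := regular_bound m kappa Hm Hreg.
rewrite step_eq in bound.
(* In each case the bound is the largest m of the given residue classes below 2 h kappa, which is
   40, 150, 200 or 720 for h = 1, 3, 4 or 12. *)
split; last split; last split; last split; last split; move=> H4 H3;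
  move: bound; case: Z.eqb_spec => E3; case: Z.eqb_spec => E4; try (exfalso; zdiv_lia).
- move=> /(_ 20%N (Or41 _ _ _ (conj erefl erefl))); zdiv_lia.
- move=> /(_ 25%N (Or42 _ _ _ (conj erefl erefl))); zdiv_lia.
- move=> /(_ 20%N (Or41 _ _ _ (conj erefl erefl))); zdiv_lia.
- move=> /(_ 25%N (Or42 _ _ _ (conj erefl erefl))); zdiv_lia.
- move=> /(_ 25%N (Or43 _ _ _ (conj erefl erefl))); zdiv_lia.
- move=> /(_ 30%N (Or44 _ _ _ (conj erefl erefl))); zdiv_lia.
Qed.
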